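(* Let $k$ be a field, let $H$ be a finite-dimensional commutative Hopf algebra over $k$, and let $T$ be a left $H$-torsor. Let $A$ be an $\mathbb N$-graded right $H$-comodule algebra. If $A$ satisfies condition $\chi$, then so does $\widetilde A$.
   Context: A right (left) $H$-comodule algebra is an algebra object in the monoidal category of right (left) $H$-comodules. A left $H$-torsor is a left $H$-comodule algebra $T$, with structure map $\rho:T\to H\otimes T$ and multiplication $m$, such that (1) $T\cong H$ as left $H$-comodules; (2) the ring of coinvariants $\{t\in T: \rho(t)=1\otimes t\}$ equals $k$; (3) the map $(\mathrm{id}\otimes m)\circ(\rho\otimes \mathrm{id}):T\otimes T\to H\otimes T$ is bijective. An $\mathbb N$-graded right $H$-comodule algebra is an $\mathbb{N}$-graded algebra $A$ that is a right $H$-comodule algebra such that every homogeneous component $A_i$ is a subcomodule. With $\rho_A:A\to A\otimes H$ its structure map, $\widetilde A=\{x\in A\otimes T:(\rho_A\otimes\mathrm{id})(x)=(\mathrm{id}\otimes\rho)(x)\}$, a graded subalgebra of $A\otimes T$ ($T$ in degree $0$). Condition $\chi$: an $\mathbb N$-graded algebra $A$ satisfies $\chi$ if for all non-negative integers $i,d$ and all finitely generated graded left $A$-modules $N$ there is an integer $n_0$ such that $\underline{\mathrm{Ext}}^i_A(A/A_{\ge n},N)_{\ge d}$ is a finitely generated left $A$-module for all $n\ge n_0$. Here $\underline{\mathrm{Ext}}^i$ are the derived functors of $\underline{\mathrm{Hom}}(M,N)=\bigoplus_{d\in\mathbb Z}\mathrm{Hom}(M,N(d))$ on graded left modules, and the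 left $A$-module structure comes from the right $A$-action on $A/A_{\ge n}$. *)

(* Defs.v *)
Set Warnings "-notation-overridden,-ambiguous-paths,-notation-incompatible-prefix,-redundant-canonical-projection,-projection-no-head-constant".
From HB Require Import structures.
From mathcomp Require Import all_boot all_algebra.
From mathcomp Require Import mathcomp_extra boolp classical_sets functions.

Set Implicit Arguments.
Unset Strict Implicit.
Unset Printing Implicit Defensive.
Import GRing.Theory.
Local Open Scope ring_scope.
Local Open Scope quotient_scope.
Local Open Scope classical_set_scope.

(* Unital associative algebras over k.  Unlike for [algType], the zero algebra
   is allowed. *)
HB.mixin Record isPzAlgebra (k : pzRingType) A of GRing.PzRing A := {
  alg_scale : k -> A -> A;
  alg_scaleA : forall a b x, alg_scale a (alg_scale b x) = alg_scale (a * b) x;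
  alg_scale1 : left_id 1 alg_scale;
  alg_scaleDr : right_distributive alg_scale +%R;
  alg_scaleDl : forall x, {morph alg_scale^~ x : a b / a + b};
  alg_scaleAl : forall a x y, alg_scale a (x * y) = alg_scale a x * y;
  alg_scaleAr : forall a x y, alg_scale a (x * y) = x * alg_scale a y }.

#[short(type="pzAlgType")]
HB.structure Definition PzAlgebra (k : pzRingType) :=
  { A of GRing.PzRing A & isPzAlgebra k A }.

#[non_forgetful_inheritance]
HB.instance Definition _ (k : pzRingType) (A : pzAlgType k) :=
  GRing.Zmodule_isLmodule.Build k (PzAlgebra.sort A)
    alg_scaleA alg_scale1 alg_scaleDr alg_scaleDl.

Coercion PzAlgebra_sort__canonical__GRing_Lmodule :
  PzAlgebra.type >-> GRing.Lmodule.type.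

Lemma pzscalerAl (k : pzRingType) (A : pzAlgType k) (c : k) (x y : A) :
  c *: (x * y) = (c *: x) * y.
Proof. exact: alg_scaleAl. Qed.

Lemma pzscalerAr (k : pzRingType) (A : pzAlgType k) (c : k) (x y : A) :
  c *: (x * y) = x * (c *: y).
Proof. exact: alg_scaleAr. Qed.

Section Tensor.
Variables (k : fieldType) (V W : lmodType k).

Definition tsum (U : zmodType) (B : V -> W -> U) (s : seq (V * W)) : U :=
  \sum_(p <- s) B p.1 p.2.

(* The list s stands for the formal sum of the v \ot w with (v, w) in s; two
   formal sums are identified when no bilinear map tells them apart. *)
Definition tens_rel (s t : seq (V * W)) : bool :=
  `[< forall (U : lmodType k) (B : V -> W -> U),
        bilinear_for *:%R *:%R B -> tsum B s = tsum B t >].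

Lemma tens_rel_equiv : equiv_class_of tens_rel.
Proof.
split=> [s|s t|t s u]; first by apply/asboolP.
  by apply/asboolP/asboolP => h U B hB; rewrite (h U B hB).
move=> /asboolP h1 /asboolP h2; apply/asboolP => U B hB.
by rewrite (h1 U B hB) (h2 U B hB).
Qed.

Canonical tens_equivRel := EquivRelPack tens_rel_equiv.
Canonical tens_encModRel := defaultEncModRel tens_rel.

Definition tens := {eq_quot tens_rel}.
HB.instance Definition _ : EqQuotient _ tens_rel tens := EqQuotient.on tens.
HB.instance Definition _ := Choice.on tens.

Definition pure (v : V) (w : W) : tens := \pi_tens [:: (v, w)].

Definition tlift (U : zmodType) (B : V -> W -> U) (x : tens) : U :=
  tsum B (repr x).

Lemma tlift_pi (U : lmodType k) (B : V -> W -> U) s :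
  bilinear_for *:%R *:%R B -> tlift B (\pi_tens s) = tsum B s.
Proof.
move=> hB; rewrite /tlift; have : \pi_tens (repr (\pi_tens s)) = \pi_tens s.
  by rewrite reprK.
by move=> /eqP; rewrite piE => /asboolP /(_ U B hB).
Qed.

Lemma tlift_pure (U : lmodType k) (B : V -> W -> U) v w :
  bilinear_for *:%R *:%R B -> tlift B (pure v w) = B v w.
Proof. by move=> hB; rewrite tlift_pi // /tsum big_seq1. Qed.

Lemma tens_eqP (x y : tens) :
  (forall (U : lmodType k) (B : V -> W -> U),
     bilinear_for *:%R *:%R B -> tlift B x = tlift B y) -> x = y.
Proof.
move=> h; rewrite -[x]reprK -[y]reprK; apply/eqP; rewrite piE.
by apply/asboolP => U B hB; apply: h.
Qed.

Let bil0l (U : lmodType k) (B : V -> W -> U) (hB : bilinear_for *:%R *:%R B) w :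
  B 0 w = 0.
Proof. by have /= := hB.1 w (-1) 0 0; rewrite scaler0 add0r scaleN1r addNr. Qed.

Let bilZl (U : lmodType k) (B : V -> W -> U) (hB : bilinear_for *:%R *:%R B)
  c v w : B (c *: v) w = c *: B v w.
Proof. by have /= := hB.1 w c v 0; rewrite (bil0l hB) !addr0. Qed.

Definition tens0 : tens := \pi_tens [::].
Definition tens_add (x y : tens) : tens := \pi_tens (repr x ++ repr y).
Definition tens_scale (c : k) (x : tens) : tens :=
  \pi_tens [seq (c *: p.1, p.2) | p <- repr x].
Definition tens_opp (x : tens) : tens := tens_scale (-1) x.

Section Ops.
Variables (U : lmodType k) (B : V -> W -> U) (hB : bilinear_for *:%R *:%R B).

Let lift0 : tlift B tens0 = 0.
Proof. by rewrite tlift_pi // /tsum big_nil. Qed.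

Let liftD x y : tlift B (tens_add x y) = tlift B x + tlift B y.
Proof. by rewrite tlift_pi // /tsum big_cat. Qed.

Let liftZ c x : tlift B (tens_scale c x) = c *: tlift B x.
Proof.
rewrite tlift_pi // /tlift /tsum big_map scaler_sumr.
by apply: eq_bigr => p _ /=; apply: bilZl.
Qed.

Let liftN x : tlift B (tens_opp x) = - tlift B x.
Proof. by rewrite liftZ scaleN1r. Qed.

Definition tlift_ops := (lift0, liftD, liftN, liftZ).
End Ops.

Lemma tens_addA : associative tens_add.
Proof. by move=> x y z; apply: tens_eqP => U B hB; rewrite !(tlift_ops hB) addrA. Qed.
Lemma tens_addC : commutative tens_add.
Proof. by move=> x y; apply: tens_eqP => U B hB; rewrite !(tlift_ops hB) addrC. Qed.
Lemma tens_add0 : left_id tens0 tens_add.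
Proof. by move=> x; apply: tens_eqP => U B hB; rewrite !(tlift_ops hB) add0r. Qed.
Lemma tens_addN : left_inverse tens0 tens_opp tens_add.
Proof. by move=> x; apply: tens_eqP => U B hB; rewrite !(tlift_ops hB) addNr. Qed.

HB.instance Definition _ :=
  GRing.isZmodule.Build tens tens_addA tens_addC tens_add0 tens_addN.

Lemma tens_scaleA (a b : k) (x : tens) :
  tens_scale a (tens_scale b x) = tens_scale (a * b) x.
Proof. by apply: tens_eqP => U B hB; rewrite !(tlift_ops hB) scalerA. Qed.
Lemma tens_scale1 : left_id 1 tens_scale.
Proof. by move=> x; apply: tens_eqP => U B hB; rewrite !(tlift_ops hB) scale1r. Qed.
Lemma tens_scaleDr : right_distributive tens_scale tens_add.
Proof. by move=> c x y; apply: tens_eqP => U B hB; rewrite !(tlift_ops hB) scalerDr. Qed.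
Lemma tens_scaleDl (x : tens) (a b : k) :
  tens_scale (a + b) x = tens_add (tens_scale a x) (tens_scale b x).
Proof. by apply: tens_eqP => U B hB; rewrite !(tlift_ops hB) scalerDl. Qed.

HB.instance Definition _ := GRing.Zmodule_isLmodule.Build k tens
  tens_scaleA tens_scale1 tens_scaleDr tens_scaleDl.

Lemma tlift_linear (U : lmodType k) (B : V -> W -> U) :
  bilinear_for *:%R *:%R B -> linear (tlift B).
Proof. by move=> hB c x y; rewrite !(tlift_ops hB). Qed.

Lemma pure_bilinear : bilinear_for *:%R *:%R pure.
Proof.
split=> [w c v v'|v c w w']; apply: tens_eqP => U B hB.
- by rewrite (tlift_linear hB) !tlift_pure // hB.1.
- by rewrite (tlift_linear hB) !tlift_pure // hB.2.
Qed.

Lemma tens_sumE (x : tens) : x = \sum_(p <- repr x) pure p.1 p.2.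
Proof.
rewrite -[LHS]reprK; elim: (repr x) => [|p s IH]; first by rewrite big_nil.
rewrite big_cons -IH; apply: tens_eqP => U B hB.
rewrite tlift_pi // (tlift_ops hB) tlift_pure // tlift_pi //.
by rewrite /tsum big_cons.
Qed.

Lemma tens_ind (P : tens -> Prop) :
  P 0 -> (forall x y, P x -> P y -> P (x + y)) ->
  (forall v w, P (pure v w)) -> forall x, P x.
Proof.
by move=> P0 PD Pp x; rewrite (tens_sumE x); elim/big_rec: _ => // p y _; apply: PD.
Qed.

End Tensor.

Arguments pure {k V W}.

Notation "V ⊗ W" := (tens V W) (at level 40, left associativity).
Notation "v \ot w" := (pure v w)
  (at level 40, left associativity) : ring_scope.

Section TensorMaps.
Variable k : fieldType.
Implicit Types U V W : lmodType k.

Lemma bilinearP U V W (B : U -> V -> W) :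
  (forall v, linear (B^~ v)) -> (forall u, linear (B u)) ->
  bilinear_for *:%R *:%R B.
Proof. by []. Qed.

Lemma pureDl V W (v v' : V) (w : W) : (v + v') \ot w = v \ot w + v' \ot w.
Proof. by have /= := (pure_bilinear V W).1 w 1 v v'; rewrite !scale1r. Qed.
Lemma pureDr V W (v : V) (w w' : W) : v \ot (w + w') = v \ot w + v \ot w'.
Proof. by have /= := (pure_bilinear V W).2 v 1 w w'; rewrite !scale1r. Qed.
Lemma pure0l V W (w : W) : (0 : V) \ot w = 0.
Proof. by apply: (addrI (0 \ot w)); rewrite -pureDl !addr0. Qed.
Lemma pure0r V W (v : V) : v \ot (0 : W) = 0.
Proof. by apply: (addrI (v \ot 0)); rewrite -pureDr !addr0. Qed.
Lemma pureZl V W c (v : V) (w : W) : (c *: v) \ot w = c *: (v \ot w).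
Proof.
by have /= := (pure_bilinear V W).1 w c v 0; rewrite pure0l !addr0.
Qed.
Lemma pureZr V W c (v : V) (w : W) : v \ot (c *: w) = c *: (v \ot w).
Proof.
by have /= := (pure_bilinear V W).2 v c w 0; rewrite pure0r !addr0.
Qed.

Lemma morphD0 (X Y : zmodType) (F : X -> Y) :
  {morph F : x y / x + y} -> F 0 = 0.
Proof. by move=> FD; apply: (addrI (F 0)); rewrite -FD !addr0. Qed.

Lemma tens_ext V W (U : zmodType) (F G : V ⊗ W -> U) :
  {morph F : x y / x + y} -> {morph G : x y / x + y} ->
  (forall v w, F (v \ot w) = G (v \ot w)) -> F =1 G.
Proof.
move=> FD GD FG x; elim/tens_ind: x => [|x y Fx Fy|//].
- by rewrite !morphD0.
- by rewrite FD GD Fx Fy.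
Qed.

Lemma linD U V (f : U -> V) : linear f -> {morph f : x y / x + y}.
Proof. by move=> lf x y; have := lf 1 x y; rewrite !scale1r. Qed.
Lemma lin0 U V (f : U -> V) : linear f -> f 0 = 0.
Proof.
by move=> lf; apply/morphD0/linD.
Qed.
Lemma linZ U V (f : U -> V) : linear f -> forall c x, f (c *: x) = c *: f x.
Proof. by move=> lf c x; have := lf c x 0; rewrite (lin0 lf) !addr0. Qed.

Definition tmap V W V' W' (f : V -> V') (g : W -> W') : V ⊗ W -> V' ⊗ W' :=
  tlift (fun v w => f v \ot g w).

Section Tmap.
Variables (V W V' W' : lmodType k) (f : V -> V') (g : W -> W').
Hypotheses (lf : linear f) (lg : linear g).

Lemma tmap_bilinear : bilinear_for *:%R *:%R (fun v w => f v \ot g w).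
Proof.
by split=> [w c v v'|v c w w'] /=; rewrite (lf, lg) (pureDl, pureDr) (pureZl, pureZr).
Qed.
Lemma tmap_linear : linear (tmap f g).
Proof. exact: tlift_linear tmap_bilinear. Qed.
Lemma tmap_pure v w : tmap f g (v \ot w) = f v \ot g w.
Proof. by rewrite /tmap tlift_pure //; apply: tmap_bilinear. Qed.
End Tmap.

Definition tassoc U V W : (U ⊗ V) ⊗ W -> U ⊗ (V ⊗ W) :=
  tlift (fun x w => tlift (fun u v => u \ot (v \ot w)) x).

Section Tassoc.
Variables U V W : lmodType k.

Let bil1 (w : W) : bilinear_for *:%R *:%R (fun (u : U) (v : V) => u \ot (v \ot w)).
Proof.
split=> [v c u u'|u c v v'] /=; first by rewrite pureDl pureZl.
by rewrite pureDl pureDr pureZl pureZr.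
Qed.

Let bil2 : bilinear_for *:%R *:%R
  (fun (x : U ⊗ V) (w : W) => tlift (fun u v => u \ot (v \ot w)) x).
Proof.
split=> [w|x c w w']; first exact: tlift_linear.
rewrite /=; elim/tens_ind: x => [|x y hx hy|u v].
- by rewrite !(lin0 (tlift_linear (bil1 _))) scaler0 addr0.
- by rewrite !(linD (tlift_linear (bil1 _))) hx hy scalerDr addrACA.
- by rewrite !tlift_pure // pureDr pureZr pureDr pureZr.
Qed.

Lemma tassoc_linear : linear (@tassoc U V W).
Proof. exact: tlift_linear bil2. Qed.
Lemma tassoc_pure u v w : tassoc ((u \ot v) \ot w) = u \ot (v \ot w) :> U ⊗ (V ⊗ W).
Proof. by rewrite /tassoc tlift_pure // tlift_pure. Qed.
End Tassoc.

End TensorMaps.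

Section TensorAlgebra.
Variables (k : fieldType) (A B : pzAlgType k).

Definition tmul (x y : A ⊗ B) : A ⊗ B :=
  tlift (fun (a : A) (b : B) =>
    tlift (fun (a' : A) (b' : B) => (a * a') \ot (b * b')) y) x.

Let bil1 (a : A) (b : B) :
  bilinear_for *:%R *:%R (fun (a' : A) (b' : B) => (a * a') \ot (b * b')).
Proof.
split=> [b' c a' a''|a' c b' b''] /=.
  by rewrite mulrDr -pzscalerAr pureDl pureZl.
by rewrite mulrDr -pzscalerAr pureDr pureZr.
Qed.

Let bil2 (y : A ⊗ B) : bilinear_for *:%R *:%R
  (fun (a : A) (b : B) =>
    tlift (fun (a' : A) (b' : B) => (a * a') \ot (b * b')) y).
Proof.
elim/tens_ind: y => [|x y hx hy|a' b'].
- split=> [b c a a'|a c b b'] /=; rewrite !(lin0 (tlift_linear (bil1 _ _)));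
  by rewrite scaler0 addr0.
- split=> [b c a a'|a c b b'] /=; rewrite !(linD (tlift_linear (bil1 _ _))).
  + by have /= -> := hx.1 b c a a'; have /= -> := hy.1 b c a a'; rewrite scalerDr addrACA.
  + by have /= -> := hx.2 a c b b'; have /= -> := hy.2 a c b b'; rewrite scalerDr addrACA.
- split=> [b c a a''|a c b b''] /=; rewrite !tlift_pure //.
  + by rewrite mulrDl -pzscalerAl pureDl pureZl.
  + by rewrite mulrDl -pzscalerAl pureDr pureZr.
Qed.

Lemma tmul_pure a b a' b' : tmul (a \ot b) (a' \ot b') = (a * a') \ot (b * b').
Proof. by rewrite /tmul tlift_pure // tlift_pure. Qed.

Lemma tmulDl : left_distributive tmul +%R.
Proof. by move=> x x' y; rewrite /tmul (linD (tlift_linear (bil2 y))). Qed.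
Lemma tmulDr : right_distributive tmul +%R.
Proof.
move=> x y y'; elim/tens_ind: x => [|x x' hx hx'|a b].
- by rewrite /tmul !(lin0 (tlift_linear (bil2 _))) addr0.
- by rewrite !tmulDl hx hx' addrACA.
- by rewrite /tmul !tlift_pure // (linD (tlift_linear (bil1 a b))).
Qed.

Lemma tmulA : associative tmul.
Proof.
move=> x y z; move: x.
apply: tens_ext => [x x'|x x'|a b]; rewrite ?tmulDl //; move: y.
apply: tens_ext => [y y'|y y'|a' b']; rewrite ?(tmulDl, tmulDr) //; move: z.
apply: tens_ext => [z z'|z z'|a'' b'']; rewrite ?(tmulDl, tmulDr) //.
by rewrite !tmul_pure !mulrA.
Qed.
Lemma tmul1l : left_id ((1 : A) \ot (1 : B)) tmul.
Proof.
apply: tens_ext => [x x'|x x'|a b]; rewrite ?tmulDr //.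
by rewrite tmul_pure !mul1r.
Qed.
Lemma tmul1r : right_id ((1 : A) \ot (1 : B)) tmul.
Proof.
apply: tens_ext => [x x'|x x'|a b]; rewrite ?tmulDl //.
by rewrite tmul_pure !mulr1.
Qed.

HB.instance Definition _ := GRing.Zmodule_isPzRing.Build (tens A B)
  tmulA tmul1l tmul1r tmulDl tmulDr.

Lemma mul_pure a b a' b' :
  (a \ot b : A ⊗ B) * (a' \ot b') = (a * a') \ot (b * b').
Proof. exact: tmul_pure. Qed.
Lemma one_pure : 1 = (1 : A) \ot (1 : B) :> A ⊗ B.
Proof. by []. Qed.

Lemma tens_scaleAl (c : k) (x y : A ⊗ B) :
  tens_scale c (x * y) = tens_scale c x * y.
Proof. exact/esym/(linZ (tlift_linear (bil2 y))). Qed.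
Lemma tens_scaleAr (c : k) (x y : A ⊗ B) :
  tens_scale c (x * y) = x * tens_scale c y.
Proof.
move: x; apply: tens_ext => [x x'|x x'|a b].
- by rewrite mulrDl; apply: tens_scaleDr.
- by rewrite mulrDl.
- rewrite [LHS](_ : _ = c *: ((a \ot b) * y)) // /GRing.mul /= /tmul.
  by rewrite !tlift_pure // (linZ (tlift_linear (bil1 a b))).
Qed.

HB.instance Definition _ := isPzAlgebra.Build k (tens A B)
  (@tens_scaleA k A B) (@tens_scale1 k A B) (@tens_scaleDr k A B)
  (@tens_scaleDl k A B) tens_scaleAl tens_scaleAr.

Definition mulmap (x : A ⊗ A) : A := tlift (fun a b : A => a * b) x.

End TensorAlgebra.

Section TensorMorphisms.
Variable k : fieldType.

Lemma tmap_mul (A B A' B' : pzAlgType k) (f : A -> A') (g : B -> B') :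
  linear f -> linear g -> {morph f : x y / x * y} -> {morph g : x y / x * y} ->
  {morph (tmap f g : A ⊗ B -> A' ⊗ B') : x y / x * y}.
Proof.
move=> lf lg fM gM x y; have tD := linD (tmap_linear lf lg).
move: x; apply: tens_ext => [x x'|x x'|a b].
- by rewrite mulrDl tD.
- by rewrite tD mulrDl.
move: y; apply: tens_ext => [y y'|y y'|a' b'].
- by rewrite mulrDr tD.
- by rewrite tD mulrDr.
by rewrite mul_pure !tmap_pure // mul_pure fM gM.
Qed.

Lemma tassoc_mul (A B C : pzAlgType k)
    (x y : tens (tens A B : pzAlgType k) C) :
  (tassoc (x * y) : tens A (tens B C : pzAlgType k)) =
  (tassoc x : tens A (tens B C : pzAlgType k)) *
  (tassoc y : tens A (tens B C : pzAlgType k)).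
Proof.
have aD : {morph (fun x : (A ⊗ B) ⊗ C =>
    tassoc x : tens A (tens B C : pzAlgType k)) : x y / x + y}.
  exact: (linD (@tassoc_linear _ _ _ _)).
move: x; apply: tens_ext => [x x'|x x'|u c]; rewrite ?mulrDl ?aD ?mulrDl //.
move: y; apply: tens_ext => [y y'|y y'|u' c']; rewrite ?mulrDr ?aD ?mulrDr //.
rewrite mul_pure; move: u; apply: tens_ext => [u1 u2|u1 u2|a b].
- by rewrite mulrDl pureDl aD.
- by rewrite pureDl aD mulrDl.
move: u'; apply: tens_ext => [u1 u2|u1 u2|a' b'].
- by rewrite mulrDr pureDl aD.
- by rewrite pureDl aD mulrDr.
by rewrite mul_pure !tassoc_pure !mul_pure.
Qed.

End TensorMorphisms.

Section HopfTorsor.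
Variable k : fieldType.

Record hopf_algebra (H : pzAlgType k) := HopfAlgebra {
  comul : {linear H -> H ⊗ H};
  counit : {linear H -> k^o};
  antipode : {linear H -> H};
  comul_morphism : monoid_morphism comul;
  counit_morphism : monoid_morphism counit;
  comulA : forall h,
    tassoc (tmap comul idfun (comul h)) = tmap idfun comul (comul h);
  counitl : forall h, tlift (fun a b : H => counit a *: b) (comul h) = h;
  counitr : forall h, tlift (fun a b : H => counit b *: a) (comul h) = h;
  antipodel : forall h,
    tlift (fun a b : H => antipode a * b) (comul h) = counit h *: (1 : H);
  antipoder : forall h,
    tlift (fun a b : H => a * antipode b) (comul h) = counit h *: (1 : H) }.

(* The multiplication and the unit of A are comodule maps, for the diagonal
   coaction on A ⊗ A and the trivial one on k, exactly when the coaction is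
   multiplicative and unital. *)
Record right_comodule_algebra (H : pzAlgType k) (hH : hopf_algebra H)
    (A : pzAlgType k) := RightComoduleAlgebra {
  rcoact :> {linear A -> A ⊗ H};
  rcoactA : forall a,
    tassoc (tmap rcoact idfun (rcoact a)) = tmap idfun (comul hH) (rcoact a);
  rcoact1 : forall a,
    tlift (fun (x : A) (h : H) => counit hH h *: x) (rcoact a) = a;
  rcoact_morphism : monoid_morphism rcoact }.

Record left_comodule_algebra (H : pzAlgType k) (hH : hopf_algebra H)
    (T : pzAlgType k) := LeftComoduleAlgebra {
  lcoact :> {linear T -> H ⊗ T};
  lcoactA : forall t,
    tassoc (tmap (comul hH) idfun (lcoact t)) = tmap idfun lcoact (lcoact t);
  lcoact1 : forall t,
    tlift (fun (h : H) (x : T) => counit hH h *: x) (lcoact t) = t;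
  lcoact_morphism : monoid_morphism lcoact }.

Definition torsor_map (H : pzAlgType k) (hH : hopf_algebra H) (T : pzAlgType k)
    (rho : left_comodule_algebra hH T) (x : T ⊗ T) : H ⊗ T :=
  tmap idfun (@mulmap k T) (tassoc (tmap rho idfun x)).

Record is_torsor (H : pzAlgType k) (hH : hopf_algebra H) (T : pzAlgType k)
    (rho : left_comodule_algebra hH T) : Prop := IsTorsor {
  torsor_iso : exists2 f : {linear T -> H}, bijective f &
    forall t, tmap idfun f (rho t) = comul hH (f t);
  torsor_coinv : forall t : T,
    rho t = (1 : H) \ot t <-> exists c : k, t = c *: (1 : T);
  torsor_galois : bijective (torsor_map rho) }.

End HopfTorsor.

Section Gradings.

(* The sum of the subgroups P i for i in J. *)
Definition gsum (I : eqType) (V : zmodType) (P : I -> set V) (J : set I) :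
    set V :=
  [set x | exists (s : seq I) (c : I -> V),
     (forall i, i \in s -> J i /\ P i (c i)) /\ x = \sum_(i <- s) c i].

(* V is the internal direct sum of the subgroups P i. *)
Record is_grading (I : eqType) (V : zmodType) (P : I -> set V) : Prop :=
  IsGrading {
  gr_zero : forall i, P i 0;
  gr_sub : forall i x y, P i x -> P i y -> P i (x - y);
  gr_span : forall x, gsum P setT x;
  gr_indep : forall (s : seq I) (c : I -> V), uniq s ->
    (forall i, P i (c i)) -> \sum_(i <- s) c i = 0 ->
    forall i, i \in s -> c i = 0 }.

Record graded_ring (R : pzRingType) := GradedRing {
  gr_comp :> nat -> set R;
  gr_grading : is_grading gr_comp;
  gr_one : gr_comp 0%N 1;
  gr_mul : forall i j x y,
    gr_comp i x -> gr_comp j y -> gr_comp (i + j)%N (x * y) }.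

Definition graded_algebra (k : pzRingType) (A : pzAlgType k)
    (G : graded_ring A) : Prop :=
  forall i (c : k) (x : A), G i x -> G i (c *: x).

Section Theory.
Variables (I : eqType) (V : zmodType) (P : I -> set V) (gP : is_grading P).

Lemma grN i x : P i x -> P i (- x).
Proof. by move=> Px; rewrite -sub0r; apply: (gr_sub gP) => //; apply: gr_zero. Qed.
Lemma grD i x y : P i x -> P i y -> P i (x + y).
Proof. by move=> Px Py; rewrite -[y]opprK; apply: (gr_sub gP) => //; apply: grN. Qed.
Lemma grMn i x n : P i x -> P i (x *+ n).
Proof.
move=> Px; elim: n => [|n IH]; first by rewrite mulr0n; apply: (gr_zero gP).
by rewrite mulrS; apply: grD.
Qed.

Definition gdecomp (x : V) (s : seq I) (c : I -> V) : Prop :=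
  [/\ uniq s, forall i, P i (c i), forall i, i \notin s -> c i = 0
    & x = \sum_(i <- s) c i].

Lemma gdecomp_widen x s c u :
  gdecomp x s c -> uniq u -> {subset s <= u} -> gdecomp x u c.
Proof.
move=> [us Pc c0 ->] uu su; split=> // [i iu|].
  by apply: c0; apply: contra iu; apply: su.
rewrite [RHS](bigID (mem s)) /= [X in _ + X]big1 ?addr0; last by move=> i /c0.
rewrite -[RHS]big_filter; apply: perm_big; apply: uniq_perm => //.
  exact: filter_uniq.
by move=> i; rewrite mem_filter; apply/idP/andP => [h|[]//]; split=> //; apply: su.
Qed.

Lemma gdecomp_ex x : exists c s, gdecomp x s c.
Proof.
have [s [c [sP ->]]] := gr_span gP x.
exists (fun i => c i *+ count_mem i s), (undup s); split.
- exact: undup_uniq.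
- move=> i; have [/sP[_]|/count_memPn->] := boolP (i \in s); first exact: grMn.
  by rewrite mulr0n; apply: (gr_zero gP).
- by move=> i; rewrite mem_undup => /count_memPn->; rewrite mulr0n.
- by rewrite -[LHS]big_undup_iterop_count.
Qed.

Definition gproj (x : V) : I -> V := sval (cid (gdecomp_ex x)).

Lemma gprojP x : exists s, gdecomp x s (gproj x).
Proof. by rewrite /gproj; case: cid. Qed.

Lemma gprojE x s c : gdecomp x s c -> gproj x =1 c.
Proof.
move=> h1 i; have [t h2] := gprojP x.
pose u := undup (s ++ t).
have [_ P1 z1 e1] : gdecomp x u c.
  apply: gdecomp_widen h1 _ _; first exact: undup_uniq.
  by move=> j js; rewrite mem_undup mem_cat js.
have [_ P2 z2 e2] : gdecomp x u (gproj x).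
  apply: gdecomp_widen h2 _ _; first exact: undup_uniq.
  by move=> j js; rewrite mem_undup mem_cat js orbT.
have [iu|iu] := boolP (i \in u); last by rewrite z1 ?z2.
apply/eqP; rewrite -subr_eq0; apply/eqP.
apply: (gr_indep gP (s := u) (c := fun j => gproj x j - c j)) => //.
- exact: undup_uniq.
- by move=> j; apply: (gr_sub gP).
- by rewrite sumrB -e1 -e2 subrr.
Qed.

Lemma gproj_homo i x j : P i x -> gproj x j = if j == i then x else 0.
Proof.
move=> Px; apply: (@gprojE _ [:: i] (fun j => if j == i then x else 0)).
split=> //; last by rewrite big_seq1 eqxx.
- by move=> l; case: eqP => [->//|_]; apply: (gr_zero gP).
- by move=> l; rewrite inE => /negPf->.
Qed.

Lemma gprojB x y i : gproj (x - y) i = gproj x i - gproj y i.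
Proof.
have [s h1] := gprojP x; have [t h2] := gprojP y.
pose u := undup (s ++ t).
have [_ P1 z1 e1] : gdecomp x u (gproj x).
  apply: gdecomp_widen h1 _ _; first exact: undup_uniq.
  by move=> j js; rewrite mem_undup mem_cat js.
have [_ P2 z2 e2] : gdecomp y u (gproj y).
  apply: gdecomp_widen h2 _ _; first exact: undup_uniq.
  by move=> j js; rewrite mem_undup mem_cat js orbT.
apply: (@gprojE _ u (fun j => gproj x j - gproj y j)); split=> //.
- exact: undup_uniq.
- by move=> j; apply: (gr_sub gP).
- by move=> j ju; rewrite z1 ?z2 ?subr0.
- by rewrite sumrB -e1 -e2.
Qed.

Lemma gproj_comp x i : P i (gproj x i).
Proof. by have [s []] := gprojP x. Qed.

End Theory.
End Gradings.

Section Twist.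
Variables (k : fieldType) (H : pzAlgType k) (hH : hopf_algebra H).
Variables (A T : pzAlgType k).
Variables (rA : right_comodule_algebra hH A) (rT : left_comodule_algebra hH T).

(* The algebra \tilde A of the x in A ⊗ T with (rho_A ⊗ id) x = (id ⊗ rho) x,
   where (A ⊗ H) ⊗ T is identified with A ⊗ (H ⊗ T). *)
Definition cotensor_lhs (x : A ⊗ T) : A ⊗ (H ⊗ T) := tassoc (tmap rA idfun x).
Definition cotensor_rhs (x : A ⊗ T) : A ⊗ (H ⊗ T) := tmap idfun rT x.

Definition cotensor_pred : {pred A ⊗ T} :=
  [pred x | `[< cotensor_lhs x = cotensor_rhs x >]].

Record cotensor := Cotensor {
  cotensor_val : A ⊗ T;
  cotensorP : cotensor_val \in cotensor_pred }.

HB.instance Definition _ := [isSub for cotensor_val].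
HB.instance Definition _ := [Choice of cotensor by <:].

Let lrA : linear rA := linearP rA.
Let lrT : linear rT := linearP rT.
Let lidA : linear (@idfun A) := linearP idfun.
Let lidT : linear (@idfun T) := linearP idfun.

Lemma cotensor_lhsD : {morph cotensor_lhs : x y / x + y}.
Proof.
move=> x y; rewrite /cotensor_lhs (linD (tmap_linear lrA lidT)).
by rewrite (linD (@tassoc_linear _ _ _ _)).
Qed.

Lemma cotensor_rhsD : {morph cotensor_rhs : x y / x + y}.
Proof. exact: (linD (tmap_linear lidA lrT)). Qed.

Let AHT : pzRingType := tens A (tens H T : pzAlgType k).
Let lhs (x : A ⊗ T) : AHT := cotensor_lhs x.
Let rhs (x : A ⊗ T) : AHT := cotensor_rhs x.

Let lhsD : {morph lhs : x y / x + y}. Proof. exact: cotensor_lhsD. Qed.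
Let rhsD : {morph rhs : x y / x + y}. Proof. exact: cotensor_rhsD. Qed.

Let lhsM : {morph lhs : x y / x * y}.
Proof.
move=> x y; rewrite /lhs /cotensor_lhs (tmap_mul lrA lidT) //.
- exact: tassoc_mul.
- exact: (rcoact_morphism rA).2.
Qed.
Let rhsM : {morph rhs : x y / x * y}.
Proof.
apply: (@tmap_mul _ A T A (tens H T)) => //.
exact: (lcoact_morphism rT).2.
Qed.
Let lhs1 : lhs 1 = 1.
Proof.
rewrite /lhs /cotensor_lhs one_pure tmap_pure // (rcoact_morphism rA).1.
by rewrite one_pure tassoc_pure.
Qed.
Let rhs1 : rhs 1 = 1.
Proof.
by rewrite /rhs /cotensor_rhs one_pure tmap_pure // (lcoact_morphism rT).1.
Qed.

Let cotensor_sub x y : x \in cotensor_pred -> y \in cotensor_pred ->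
  x - y \in cotensor_pred.
Proof.
move=> /asboolP ex /asboolP ey; apply/asboolP.
have lB : lhs (x - y) = lhs x - lhs y.
  by apply/eqP; rewrite eq_sym subr_eq -lhsD subrK.
have rB : rhs (x - y) = rhs x - rhs y.
  by apply/eqP; rewrite eq_sym subr_eq -rhsD subrK.
by rewrite -/(lhs _) -/(rhs _) lB rB /lhs ex ey.
Qed.

Lemma cotensor_subring : subring_closed cotensor_pred.
Proof.
split; first by apply/asboolP; rewrite -/(lhs _) -/(rhs _) lhs1 rhs1.
- exact: cotensor_sub.
move=> x y /asboolP ex /asboolP ey; apply/asboolP.
by rewrite -/(lhs _) -/(rhs _) lhsM rhsM /lhs ex ey.
Qed.

HB.instance Definition _ := GRing.SubChoice_isSubPzRing.Build
  (A ⊗ T) cotensor_pred cotensor cotensor_subring.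

(* The image of P ⊗ W in V ⊗ W, for a subspace P of V. *)
Definition tens_sub (V W : lmodType k) (P : set V) : set (V ⊗ W) :=
  [set x | exists s : seq (V * W),
     (forall p, p \in s -> P p.1) /\ x = \sum_(p <- s) p.1 \ot p.2].

Variables (G : graded_ring A) (kG : graded_algebra G).

Definition graded_coaction : Prop :=
  forall i a, G i a -> tens_sub (G i) (rA a).

Definition cotensor_comp (i : nat) : set cotensor :=
  [set x | tens_sub (G i) (val x)].

Hypothesis cG : graded_coaction.

Let gG := gr_grading G.
Let p i (a : A) : A := gproj gG a i.

Let p_lin i : linear (p i).
Proof.
have pB x y : p i (x - y) = p i x - p i y by rewrite /p gprojB.
have p0 : p i 0 = 0 by have := pB 0 0; rewrite !subrr.
have pD x y : p i (x + y) = p i x + p i y.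
  by rewrite -{1}[y]opprK pB -[- y]sub0r pB p0 sub0r opprK.
move=> c x y; rewrite pD; congr (_ + _).
have [s [us Pc c0 e]] := gprojP gG x.
apply: (@gprojE _ _ _ gG _ s (fun j => c *: gproj gG x j)); split=> //.
- by move=> j; apply: kG.
- by move=> j /c0->; rewrite scaler0.
- by rewrite {1}e scaler_sumr.
Qed.

Let pT (W : lmodType k) i : A ⊗ W -> A ⊗ W := tmap (p i) idfun.

Let lid (W : lmodType k) : linear (@idfun W).
Proof. by []. Qed.

Let pT_lin (W : lmodType k) i : linear (@pT W i).
Proof. exact: tmap_linear (p_lin i) (lid (W := W)). Qed.

Let tens_sub_pT (W : lmodType k) i j (x : A ⊗ W) :
  tens_sub (G i) x -> pT j x = if j == i then x else 0.
Proof.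
case=> s [sP ->]; elim: s sP => [|[a w] s IH] sP.
  by rewrite big_nil (lin0 (@pT_lin W j)) if_same.
rewrite big_cons (linD (@pT_lin W j)) IH; last first.
  by move=> q qs; apply: sP; rewrite inE qs orbT.
rewrite /pT tmap_pure //= /p (gproj_homo gG j (sP (a, w) (mem_head _ _))) /=.
by case: eqP => // _; rewrite pure0l addr0.
Qed.

Let tens_sub0 (W : lmodType k) i : tens_sub (G i) (0 : A ⊗ W).
Proof. by exists [::]; rewrite big_nil. Qed.

Let tens_subD (W : lmodType k) i (x y : A ⊗ W) :
  tens_sub (G i) x -> tens_sub (G i) y -> tens_sub (G i) (x + y).
Proof.
move=> [s [sP ->]] [t [tP ->]]; exists (s ++ t); rewrite big_cat; split=> // q.
by rewrite mem_cat => /orP[/sP|/tP].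
Qed.

Let tens_subN (W : lmodType k) i (x : A ⊗ W) :
  tens_sub (G i) x -> tens_sub (G i) (- x).
Proof.
move=> [s [sP ->]]; exists [seq (- q.1, q.2) | q <- s]; split.
  by move=> q /mapP[q' /sP Pq' ->] /=; apply: grN.
rewrite big_map -sumrN; apply: eq_bigr => q _ /=.
by rewrite -[- q.1]scaleN1r pureZl scaleN1r.
Qed.

Let tens_sub_range (W : lmodType k) i (x : A ⊗ W) : tens_sub (G i) (pT i x).
Proof.
elim/tens_ind: x => [|x y hx hy|a w].
- by rewrite (lin0 (@pT_lin W i)).
- by rewrite (linD (@pT_lin W i)); apply: tens_subD.
- rewrite /pT tmap_pure //; exists [:: (p i a, w)]; rewrite big_seq1; split=> //.
  by move=> q; rewrite inE => /eqP->; apply: gproj_comp.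
Qed.

Let pT_fin (W : lmodType k) (x : A ⊗ W) : exists s : seq nat, forall u,
  uniq u -> {subset s <= u} -> x = \sum_(i <- u) pT i x.
Proof.
elim/tens_ind: x => [|x y [s hx] [t hy]|a w].
- exists [::] => u _ _; rewrite big1 // => i _; exact: lin0 (@pT_lin W i).
- exists (s ++ t) => u uu su; under eq_bigr do rewrite (linD (@pT_lin W _)).
  by rewrite big_split /= -hx // -?hy // => j js;
     apply: su; rewrite mem_cat js ?orbT.
- have [s h] := gprojP gG a; exists s => u uu su.
  have [_ _ _ {1}->] := gdecomp_widen h uu su.
  elim: u {uu su} => [|i u IH]; first by rewrite !big_nil pure0l.
  by rewrite !big_cons pureDl IH /pT tmap_pure.
Qed.

Let rA_pT i (a : A) : rA (p i a) = pT i (rA a).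
Proof.
have [s [us Pc c0 e]] := gprojP gG a.
rewrite {2}e (big_morph rA (id1 := 0) (op1 := +%R)); last first.
- exact: lin0.
- exact: linD.
rewrite (big_morph (@pT H i) (id1 := 0) (op1 := +%R)); last first.
- exact: lin0 (@pT_lin H i).
- exact: linD (@pT_lin H i).
have [is_|is_] := boolP (i \in s).
  rewrite (bigD1_seq i) //= big1 ?addr0.
    by rewrite (tens_sub_pT _ (cG (Pc i))) eqxx.
  move=> j ji; rewrite (tens_sub_pT _ (cG (Pc j))) eq_sym.
  by rewrite (negPf ji).
rewrite /p c0 // (lin0 lrA) big_seq big1 // => j js.
rewrite (tens_sub_pT _ (cG (Pc j))); case: eqP => // ij.
by move: is_; rewrite ij js.
Qed.

Let cotensor_pT i (x : A ⊗ T) :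
  x \in cotensor_pred -> pT i x \in cotensor_pred.
Proof.
move=> /asboolP ex; apply/asboolP.
have -> : cotensor_rhs (pT i x) = pT i (cotensor_rhs x).
  move: x {ex}; apply: tens_ext => [x y|x y|a t].
  - by rewrite (linD (@pT_lin T i)) cotensor_rhsD.
  - by rewrite cotensor_rhsD (linD (@pT_lin _ i)).
  - by rewrite /cotensor_rhs /pT !tmap_pure.
rewrite -ex; move: x {ex}; apply: tens_ext => [x y|x y|a t].
- by rewrite (linD (@pT_lin T i)) cotensor_lhsD.
- by rewrite cotensor_lhsD (linD (@pT_lin _ i)).
rewrite {1}/pT tmap_pure // /cotensor_lhs !tmap_pure // rA_pT /=.
elim/tens_ind: (rA a) => [|u v hu hv|b h].
- rewrite (lin0 (@pT_lin H i)) !pure0l.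
  by rewrite !(lin0 (@tassoc_linear _ _ _ _)) (lin0 (@pT_lin _ i)).
- rewrite (linD (@pT_lin H i)) !pureDl !(linD (@tassoc_linear _ _ _ _)).
  by rewrite (linD (@pT_lin _ i)) hu hv.
- by rewrite /pT tmap_pure // !tassoc_pure tmap_pure.
Qed.

Lemma cotensor_is_grading : is_grading cotensor_comp.
Proof.
split=> [i|i x y xi yi|x|s c us cP c0 i is_].
- exact: tens_sub0.
- by apply: tens_subD => //; apply: tens_subN.
- have [s hs] := pT_fin (val x).
  exists (undup s), (fun i => Cotensor (cotensor_pT i (cotensorP x))); split.
    by move=> i _; split=> //; apply: tens_sub_range.
  apply: val_inj; rewrite raddf_sum /=; apply: hs; first exact: undup_uniq.
  by move=> j; rewrite mem_undup.
- apply: val_inj; rewrite /= -(lin0 (@pT_lin T i)).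
  have /(congr1 val) := c0; rewrite raddf_sum /= => {1}<-.
  rewrite (big_morph (@pT T i) (id1 := 0) (op1 := +%R)); last first.
  + exact: lin0 (@pT_lin T i).
  + exact: linD (@pT_lin T i).
  rewrite (bigD1_seq i) //= (tens_sub_pT _ (cP i)) eqxx big1 ?addr0 // => j ji.
  by rewrite (tens_sub_pT _ (cP j)) eq_sym (negPf ji).
Qed.

Lemma cotensor_comp1 : cotensor_comp 0%N 1.
Proof.
exists [:: (1, 1)]; rewrite big_seq1; split=> // q.
by rewrite inE => /eqP->; apply: gr_one.
Qed.

Lemma cotensor_compM i j x y :
  cotensor_comp i x -> cotensor_comp j y -> cotensor_comp (i + j)%N (x * y).
Proof.
move=> [s [sP ex]] [t [tP ey]]; rewrite /cotensor_comp /= ex ey {ex ey x y}.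
elim: s sP => [|[a u] s IH] sP; first by rewrite big_nil mul0r.
rewrite big_cons mulrDl; apply: tens_subD; last first.
  by apply: IH => q qs; apply: sP; rewrite inE qs orbT.
have {sP IH}Ga : G i a by apply: (sP (a, u)); rewrite mem_head.
elim: t tP => [|[b v] t IHt] tP; first by rewrite big_nil mulr0.
rewrite big_cons mulrDr; apply: tens_subD; last first.
  by apply: IHt => q qt; apply: tP; rewrite inE qt orbT.
exists [:: (a * b, u * v)]; rewrite big_seq1 mul_pure; split=> // q.
rewrite inE => /eqP->; apply: gr_mul => //.
by apply: (tP (b, v)); rewrite mem_head.
Qed.

Definition cotensor_graded : graded_ring cotensor :=
  GradedRing cotensor_is_grading cotensor_comp1 cotensor_compM.

End Twist.

Definition finitely_generated (R : pzRingType) (V : lmodType R) : Prop :=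
  exists (n : nat) (e : 'I_n -> V),
    forall v, exists c : 'I_n -> R, v = \sum_i c i *: e i.

Section GradedModules.
Variables (R : pzRingType) (G : graded_ring R).

Record graded_module := GradedModule {
  gm_sort :> lmodType R;
  gm_comp : int -> set gm_sort;
  gm_grading : is_grading gm_comp;
  gm_scale : forall (i : nat) (j : int) (a : R) (m : gm_sort),
    G i a -> gm_comp j m -> gm_comp (i%:Z + j) (a *: m) }.

(* Degree-preserving module maps M -> N(d), where N(d)_i = N_(i + d). *)
Definition hom_deg (M N : graded_module) (d : int) : set (M -> N) :=
  [set f | linear f /\ forall i m, gm_comp i m -> gm_comp (i + d) (f m)].

(* The part of \underline{Hom}(M, N) with degrees in J; module maps of distinct
   degrees are independent, so the direct sum over d is a sum of functions. *)
Definition uHom (M N : graded_module) (J : set int) : set (M -> N) :=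
  gsum (@hom_deg M N) J.

Definition graded_injective (E : graded_module) : Prop :=
  forall (M N : graded_module) (f : M -> N) (g : M -> E),
    hom_deg 0 f -> injective f -> hom_deg 0 g ->
    exists2 h : N -> E, hom_deg 0 h & forall m, h (f m) = g m.

Record injective_resolution (N : graded_module) := InjectiveResolution {
  ires :> nat -> graded_module;
  ires_aug : N -> ires 0%N;
  ires_diff : forall i, ires i -> ires i.+1;
  ires_inj : forall i, graded_injective (ires i);
  ires_aug_hom : hom_deg 0 ires_aug;
  ires_diff_hom : forall i, hom_deg 0 (@ires_diff i);
  ires_aug_mono : injective ires_aug;
  ires_exact0 : forall x, ires_diff x = 0 <-> exists y, x = ires_aug y;
  ires_exactS : forall i (x : ires i.+1),
    ires_diff x = 0 <-> exists y : ires i, x = ires_diff y }.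

Section Ext.
(* M is a graded left module with a right action of R, N is resolved by E; the
   i-th right derived functor of \underline{Hom}(M, -) at N is the cohomology of
   \underline{Hom}(M, E), on which R acts on the left through the right action
   on M. *)
Variables (M : graded_module) (ract : M -> R -> M).
Variables (N : graded_module) (E : injective_resolution N).

Definition ext_act (i : nat) (a : R) (f : M -> E i) : M -> E i :=
  fun m => f (ract m a).

Definition ext_cocycle (i : nat) (J : set int) : set (M -> E i) :=
  [set f | uHom J f /\ forall m, ires_diff (f m) = 0].

Definition ext_coboundary (i : nat) : set (M -> E i) :=
  match i with
  | 0%N => [set 0]
  | j.+1 => [set f | exists2 g : M -> E j,
               uHom setT g & f = fun m => ires_diff (g m)]
  end.

(* Finite generation of the R-module Ext^i(M, N)_(>= d), the cocycles of degrees
   at least d modulo coboundaries. *)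
Definition ext_ge_fin_gen (i : nat) (d : int) : Prop :=
  exists (n : nat) (z : 'I_n -> M -> E i),
    (forall l, ext_cocycle [set e | d <= e] (z l)) /\
    forall f, ext_cocycle [set e | d <= e] f ->
      exists a : 'I_n -> R, ext_coboundary (f - \sum_l ext_act (a l) (z l)).

End Ext.

Definition ge_ideal (n : nat) : {pred R} :=
  [pred x | `[< gsum G [set i | (n <= i)%N] x >]].

Let gG := gr_grading G.

Lemma ge_idealP n x : reflect
  (forall i, (i < n)%N -> gproj gG x i = 0) (x \in ge_ideal n).
Proof.
apply: (iffP (asboolP _)) => [[s [c [sP ->]]] i ltin|h].
  elim: s sP => [|j s IH] sP.
    by rewrite big_nil (gproj_homo gG i (gr_zero gG i)) eqxx.
  have [/= lej Pj] := sP j (mem_head _ _).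
  rewrite big_cons -[c j]opprK addrC gprojB IH; last first.
    by move=> l ls; apply: sP; rewrite inE ls orbT.
  rewrite (gproj_homo gG i (grN gG Pj)); case: eqP => [ij|_]; last by rewrite subr0.
  by move: ltin; rewrite ij ltnNge lej.
have [s [us Pc c0 e]] := gprojP gG x.
exists [seq i <- s | (n <= i)%N], (gproj gG x); split.
  by move=> i; rewrite mem_filter => /andP[].
rewrite big_filter {1}e (bigID (fun i => (n <= i)%N)) /=.
by rewrite [X in _ + X]big1 ?addr0 // => i; rewrite -ltnNge; apply: h.
Qed.

Lemma ge_ideal_zmod n : zmod_closed (ge_ideal n).
Proof.
split=> [|x y /ge_idealP hx /ge_idealP hy]; apply/ge_idealP => i ltin.
  by rewrite (gproj_homo gG i (gr_zero gG i)) eqxx.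
by rewrite gprojB hx ?hy // subr0.
Qed.

HB.instance Definition _ n := GRing.isZmodClosed.Build R (ge_ideal n)
  (ge_ideal_zmod n).

Lemma ge_idealM n x y : y \in ge_ideal n -> x * y \in ge_ideal n.
Proof.
move=> /asboolP[s [c [sP ->]]]; rewrite mulr_sumr big_seq rpred_sum // => i /sP.
move=> [/= lei Pi]; have [t [d [tP ->]]] := gr_span gG x; rewrite mulr_suml.
rewrite big_seq rpred_sum // => j /tP[_ Pj]; apply/asboolP.
exists [:: (j + i)%N], (fun=> d j * c i); rewrite big_seq1; split=> // l.
rewrite inE => /eqP->; split; last exact: gr_mul.
by rewrite /= (leq_trans lei) ?leq_addl.
Qed.

Lemma ge_idealMr n x y : x \in ge_ideal n -> x * y \in ge_ideal n.
Proof.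
move=> /asboolP[s [c [sP ->]]]; rewrite mulr_suml big_seq rpred_sum // => i /sP.
move=> [/= lei Pi]; have [t [d [tP ->]]] := gr_span gG y; rewrite mulr_sumr.
rewrite big_seq rpred_sum // => j /tP[_ Pj]; apply/asboolP.
exists [:: (i + j)%N], (fun=> c i * d j); rewrite big_seq1; split=> // l.
rewrite inE => /eqP->; split; last exact: gr_mul.
by rewrite /= (leq_trans lei) ?leq_addr.
Qed.

Definition trunc n := {ideal_quot (ge_ideal n)}.
HB.instance Definition _ n := GRing.Zmodule.on (trunc n).

Definition trunc_pi n (x : R) : trunc n := \pi_(trunc n) x.
Definition trunc_scale n (a : R) (x : trunc n) : trunc n :=
  trunc_pi n (a * repr x).
Definition trunc_ract n (x : trunc n) (a : R) : trunc n :=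
  trunc_pi n (repr x * a).

Lemma trunc_piE n x y : trunc_pi n x = trunc_pi n y <-> x - y \in ge_ideal n.
Proof.
by rewrite /trunc_pi; split=> [/eqP|h]; [|apply/eqP]; rewrite piE.
Qed.

Lemma trunc_piD n x y : trunc_pi n (x + y) = trunc_pi n x + trunc_pi n y.
Proof. by rewrite /trunc_pi raddfD. Qed.

Lemma trunc_scale_pi n a x : trunc_scale a (trunc_pi n x) = trunc_pi n (a * x).
Proof.
apply/trunc_piE; rewrite -mulrBr; apply: ge_idealM; apply/trunc_piE.
exact: reprK.
Qed.

Lemma trunc_ract_pi n x a : trunc_ract (trunc_pi n x) a = trunc_pi n (x * a).
Proof.
apply/trunc_piE; rewrite -mulrBl; apply: ge_idealMr; apply/trunc_piE.
exact: reprK.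
Qed.

Lemma trunc_piK n (x : trunc n) : exists y, x = trunc_pi n y.
Proof. by exists (repr x); rewrite /trunc_pi reprK. Qed.

Lemma trunc_scaleA n a b (x : trunc n) :
  trunc_scale a (trunc_scale b x) = trunc_scale (a * b) x.
Proof. by have [y ->] := trunc_piK x; rewrite !trunc_scale_pi mulrA. Qed.
Lemma trunc_scale1 n : left_id 1 (@trunc_scale n).
Proof. by move=> x; have [y ->] := trunc_piK x; rewrite !trunc_scale_pi mul1r. Qed.
Lemma trunc_scaleDr n : right_distributive (@trunc_scale n) +%R.
Proof.
move=> a x y; have [x' ->] := trunc_piK x; have [y' ->] := trunc_piK y.
by rewrite -trunc_piD !trunc_scale_pi mulrDr trunc_piD.
Qed.
Lemma trunc_scaleDl n (x : trunc n) : {morph (@trunc_scale n)^~ x : a b / a + b}.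
Proof.
by move=> a b; have [y ->] := trunc_piK x; rewrite !trunc_scale_pi mulrDl trunc_piD.
Qed.

HB.instance Definition _ n := GRing.Zmodule_isLmodule.Build R (trunc n)
  (@trunc_scaleA n) (@trunc_scale1 n) (@trunc_scaleDr n) (@trunc_scaleDl n).

Definition trunc_comp n (j : int) : set (trunc n) :=
  match j with
  | Posz i => [set trunc_pi n x | x in G i]
  | Negz _ => [set 0]
  end.

Lemma trunc_is_grading n : is_grading (@trunc_comp n).
Proof.
have pi0 : trunc_pi n 0 = 0 by rewrite /trunc_pi raddf0.
have piB x y : trunc_pi n (x - y) = trunc_pi n x - trunc_pi n y.
  by rewrite /trunc_pi raddfB.
have pi_sum (I : Type) (s : seq I) (F : I -> R) :
    trunc_pi n (\sum_(i <- s) F i) = \sum_(i <- s) trunc_pi n (F i).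
  by rewrite /trunc_pi raddf_sum.
split=> [[i|i]|[i|i] x y|x|s c us cP c0 j js].
- by exists 0 => //; apply: (gr_zero gG).
- by [].
- by move=> [x' Px <-] [y' Py <-]; exists (x' - y'); [exact: (gr_sub gG)|].
- by move=> -> ->; rewrite subr0.
- have [y ->] := trunc_piK x; have [s [c [sP ->]]] := gr_span gG y.
  exists (map Posz s), (fun j => trunc_pi n (c `|j|%N)); split.
    move=> j /mapP[i /sP[_ Pi] ->]; split=> //=.
    by exists (c i).
  by rewrite big_map pi_sum.
- have ch i : exists x, (if i is Posz l then G l x else x = 0) /\
      trunc_pi n x = c i.
    by move: (cP i); case: (i) => l /=; [move=> [x Gx <-]; exists x|
      move=> ->; exists 0; rewrite pi0].
  have [d dPE] := choice ch.
  have dP i := (dPE i).1; have dE i := (dPE i).2.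
  rewrite -dE -pi0; apply/trunc_piE; rewrite subr0.
  have : \sum_(i <- s) d i \in ge_ideal n.
    rewrite -[X in X \in _]subr0; apply/trunc_piE; rewrite pi0 pi_sum.
    by under eq_bigr do rewrite dE.
  move=> /ge_idealP hs; move: (dP j) (dE j); case: j js => l ls /= Pl El; last first.
    by rewrite Pl (ge_ideal_zmod n).1.
  apply/ge_idealP => i ltin; rewrite (gproj_homo gG i Pl); case: eqP => // il.
  rewrite -(hs i ltin).
  have -> : gproj gG (\sum_(i0 <- s) d i0) i = \sum_(i0 <- s) gproj gG (d i0) i.
    elim: (s) => [|a t IH].
      by rewrite !big_nil (gproj_homo gG i (gr_zero gG i)) if_same.
    rewrite !big_cons -{1}[d a]opprK addrC gprojB IH addrC; congr (_ + _).
    by rewrite -[- d a]sub0r gprojB (gproj_homo gG i (gr_zero gG i)) if_same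
      sub0r opprK.
  rewrite (bigD1_seq _ ls us) /= (gproj_homo gG i Pl) il eqxx big1 ?addr0 // => q ql.
  move: (dP q) ql; case: q => [q Pq ql|q -> _].
    rewrite -il (gproj_homo gG _ Pq); case: eqP => // e.
    by move: ql; rewrite -e il eqxx.
  by rewrite (gproj_homo gG _ (gr_zero gG i)) if_same.
Qed.

Lemma trunc_gm_scale n (i : nat) (j : int) (a : R) (m : trunc n) :
  G i a -> trunc_comp j m -> trunc_comp (i%:Z + j) (a *: m).
Proof.
move=> Ga; case: j => j /=.
  move=> [x Gx <-]; exists (a * x); first exact: gr_mul.
  by rewrite -trunc_scale_pi.
by move=> ->; rewrite scaler0; apply: (gr_zero (trunc_is_grading n)).
Qed.

Definition trunc_gm n : graded_module :=
  GradedModule (trunc_is_grading n) (@trunc_gm_scale n).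

(* Right derived functors do not depend on the injective resolution, so
   quantifying over all of them is the same as choosing one. *)
Definition condition_chi : Prop :=
  forall (i d : nat) (N : graded_module), finitely_generated N ->
    exists n0 : nat, forall n : nat, (n0 <= n)%N ->
      forall E : injective_resolution N,
        @ext_ge_fin_gen (trunc_gm n) (@trunc_ract n) N E i d%:Z.

End GradedModules.

(* Main.v *)
Set Warnings "-notation-overridden,-ambiguous-paths,-notation-incompatible-prefix,-redundant-canonical-projection,-projection-no-head-constant".
Require Import Defs.
From HB Require Import structures.
From mathcomp Require Import all_boot all_algebra.
From mathcomp Require Import mathcomp_extra boolp classical_sets functions.

Set Implicit Arguments.
Unset Strict Implicit.
Unset Printing Implicit Defensive.
Import GRing.Theory.
Local Open Scope ring_scope.
Local Open Scope classical_set_scope.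

(* Write C for the cotensor algebra and B = A (x) T.  The elements b_i = 1 (x) t_i,
   for a basis t_i of T, form a basis of B over A on the right and, because the
   torsor map is bijective, also over C on the left.  Hence N |-> Hom_C(B, N),
   which is N^m with A acting through matrices over C, is exact and preserves
   graded injectives, and, as B (x)_A A/A_(>= n) = (C/C_(>= n))^m, adjunction gives
     Ext_A(A/A_(>= n), Hom_C(B, N)) = Ext_C(C/C_(>= n), N)^m.
   A acts on the right-hand side through matrices over C, so if it is finitely
   generated over A then each copy is finitely generated over C.  To apply
   condition chi of A one needs Hom_C(B, N) to be finitely generated over A when
   N is so over C.  Let tau(h) be the inverse image of h (x) 1 under the torsor
   map.  Then h acts on T (x) T^op by left multiplication by tau(h), this is a Hopf
   module with coinvariants 1 (x) T, and the fundamental theorem of Hopf modules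
   writes every t (x) 1 as a sum of products tau(h) (1 (x) g); so each element of C
   acts on N^m as a sum of products of elements of A with constant matrices. *)

(** * Sums of homogeneous maps *)

Section Gsum.
Variables (I : eqType) (V : zmodType) (P : I -> set V) (J : set I).

Lemma gsum_ind (Q : V -> Prop) :
  Q 0 -> (forall x y, Q x -> Q y -> Q (x + y)) ->
  (forall i x, J i -> P i x -> Q x) -> forall x, gsum P J x -> Q x.
Proof.
move=> Q0 QD QP x [s [c [sP ->]]]; elim: s sP => [|i s IH] sP.
  by rewrite big_nil.
rewrite big_cons; have [Ji Pi] := sP i (mem_head _ _).
apply: QD; first exact: QP Ji Pi.
by apply: IH => j js; apply: sP; rewrite inE js orbT.
Qed.

Lemma gsum_homo i x : J i -> P i x -> gsum P J x.
Proof.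
move=> Ji Pi; exists [:: i], (fun=> x); rewrite big_seq1; split=> // j.
by rewrite inE => /eqP->.
Qed.

Lemma gsum0 : gsum P J 0.
Proof. by exists [::], (fun=> 0); rewrite big_nil. Qed.

Hypotheses (P0 : forall i, P i 0)
  (PD : forall i x y, P i x -> P i y -> P i (x + y)).

(** The index lists may overlap and repeat, while [gsum] allows a single coefficient function. Both
    sums are therefore regrouped over the duplicate-free list [u], with coefficients weighted by
    multiplicity. *)
Lemma gsumD x y : gsum P J x -> gsum P J y -> gsum P J (x + y).
Proof.
move=> [s [c [sP ->]]] [t [d [tP ->]]].
have PMn i n z : P i z -> P i (z *+ n).
  by move=> Pz; elim: n => [|n IH]; rewrite ?mulr0n // mulrS; apply: PD.
pose u := undup (s ++ t).
have sumE r (e : I -> V) : {subset r <= u} ->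
    \sum_(i <- r) e i = \sum_(i <- u) e i *+ count_mem i r.
  move=> ru; have -> : \sum_(i <- r) e i = \sum_(i <- undup r) e i *+ count_mem i r.
    by rewrite -[LHS]big_undup_iterop_count.
  rewrite [RHS](bigID (mem r)) /= [X in _ + X]big1 ?addr0; last first.
    by move=> i /count_memPn->.
  rewrite -[RHS]big_filter; apply: perm_big; apply: uniq_perm.
  - exact: undup_uniq.
  - exact/filter_uniq/undup_uniq.
  - move=> i; rewrite mem_undup mem_filter.
    by apply/idP/andP => [h|[]//]; split=> //; apply: ru.
exists u, (fun i => c i *+ count_mem i s + d i *+ count_mem i t); split.
  move=> i; rewrite mem_undup mem_cat => iu; split.
    by case/orP: iu => [/sP|/tP] [].
  apply: PD.
  - by have [/sP[_]|/count_memPn->] := boolP (i \in s); [exact: PMn|].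
  - by have [/tP[_]|/count_memPn->] := boolP (i \in t); [exact: PMn|].
rewrite big_split /=; congr (_ + _); apply: sumE => i ir;
  by rewrite mem_undup mem_cat ir ?orbT.
Qed.

End Gsum.

Section HomDeg.
Variables (R : pzRingType) (G : graded_ring R) (M N : graded_module G).
Implicit Types (d : int) (J : set int) (f g : M -> N).

Lemma hom_deg0 d : hom_deg (N := N) d (0 : M -> N).
Proof.
split=> [c x y|i m _]; first by rewrite scaler0 addr0.
exact: (gr_zero (gm_grading N)).
Qed.

Lemma hom_degD d f g : hom_deg d f -> hom_deg d g -> hom_deg d (f + g).
Proof.
move=> [lf df] [lg dg]; split=> [c x y|i m Mm].
  by rewrite !addrfctE lf lg scalerDr addrACA.
by apply: (grD (gm_grading N)); [apply: df|apply: dg].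
Qed.

Lemma uHomD J f g : uHom J f -> uHom J g -> uHom J (f + g).
Proof.
by move=> hf hg; apply: gsumD hf hg => [i|i x y]; [exact: hom_deg0|exact: hom_degD].
Qed.

Lemma uHom_linear J f : uHom J f -> linear f.
Proof.
move: f; apply: gsum_ind => [c x y|f g lf lg c x y|d f _ []//].
  by rewrite scaler0 addr0.
by rewrite !addrfctE lf lg scalerDr addrACA.
Qed.

End HomDeg.

Section Linear.
Variables (R : pzRingType) (U V : lmodType R) (f : U -> V).
Hypothesis lf : linear f.

Lemma linearfD x y : f (x + y) = f x + f y.
Proof. by have := lf 1 x y; rewrite !scale1r. Qed.

Lemma linearf0 : f 0 = 0.
Proof. by apply: (addrI (f 0)); rewrite -linearfD !addr0. Qed.

Lemma linearfZ c x : f (c *: x) = c *: f x.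
Proof. by have := lf c x 0; rewrite linearf0 !addr0. Qed.

Lemma linearf_sum (K : Type) (r : seq K) (F : K -> U) :
  f (\sum_(l <- r) F l) = \sum_(l <- r) f (F l).
Proof. exact: (big_morph f linearfD linearf0). Qed.

End Linear.

(** * Graded ring morphisms to matrices *)

(** A unital ring morphism from R to the m x m matrices over R', given by its entries. Entries keep
    the degree because the bimodule basis that they refer to lies in degree 0. *)
Record mxhom (R R' : pzRingType) (G : graded_ring R) (G' : graded_ring R')
    (m : nat) := MxHom {
  mxhom_fun :> 'I_m -> 'I_m -> R -> R';
  mxhomD : forall i j, {morph mxhom_fun i j : x y / x + y};
  mxhom1 : forall i j, mxhom_fun i j 1 = (i == j)%:R;
  mxhomM : forall i j x y,
    mxhom_fun i j (x * y) = \sum_p mxhom_fun i p x * mxhom_fun p j y;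
  mxhom_deg : forall i j d x, G d x -> G' d (mxhom_fun i j x) }.

(* N^m as an R-module through R -> M_m(R'). *)
Definition mxpull (R R' : pzRingType) (G : graded_ring R) (G' : graded_ring R')
    (m : nat) (s : mxhom G G' m) (N : lmodType R') := {ffun 'I_m -> N}.

Section MxPull.
Variables (R R' : pzRingType) (G : graded_ring R) (G' : graded_ring R').
Variables (m : nat) (s : mxhom G G' m).

Lemma mxhom0 i j : s i j 0 = 0.
Proof. exact: (morphD0 (@mxhomD _ _ _ _ _ s i j)). Qed.

Lemma mxhomB i j x y : s i j (x - y) = s i j x - s i j y.
Proof. by apply/eqP; rewrite eq_sym subr_eq -mxhomD subrK. Qed.

Section Lmod.
Variable N : lmodType R'.

HB.instance Definition _ := GRing.Zmodule.on (mxpull s N).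

Definition mxpull_scale (a : R) (f : mxpull s N) : mxpull s N :=
  [ffun i => \sum_p s i p a *: f p].

Lemma mxpull_scaleA a b f :
  mxpull_scale a (mxpull_scale b f) = mxpull_scale (a * b) f.
Proof.
apply/ffunP => i; rewrite !ffunE.
under eq_bigr do rewrite ffunE scaler_sumr.
rewrite exchange_big /=; apply: eq_bigr => p _.
by rewrite mxhomM scaler_suml; apply: eq_bigr => q _; rewrite scalerA.
Qed.

Lemma mxpull_scale1 : left_id 1 mxpull_scale.
Proof.
move=> f; apply/ffunP => i; rewrite ffunE (bigD1 i) //= mxhom1 eqxx scale1r.
by rewrite big1 ?addr0 // => p pi; rewrite mxhom1 eq_sym (negPf pi) scale0r.
Qed.

Lemma mxpull_scaleDr : right_distributive mxpull_scale +%R.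
Proof.
move=> a f g; apply/ffunP => i; rewrite !ffunE -big_split.
by apply: eq_bigr => p _; rewrite ffunE scalerDr.
Qed.

Lemma mxpull_scaleDl f : {morph mxpull_scale^~ f : a b / a + b}.
Proof.
move=> a b; apply/ffunP => i; rewrite !ffunE -big_split.
by apply: eq_bigr => p _; rewrite mxhomD scalerDl.
Qed.

HB.instance Definition _ := GRing.Zmodule_isLmodule.Build R (mxpull s N)
  mxpull_scaleA mxpull_scale1 mxpull_scaleDr mxpull_scaleDl.

Lemma mxpullZE (a : R) (f : mxpull s N) i :
  (a *: f) i = \sum_p s i p a *: f p.
Proof. by rewrite ffunE. Qed.

Lemma mxpullDE (f g : mxpull s N) i : (f + g) i = f i + g i.
Proof. by rewrite ffunE. Qed.

Lemma mxpull0E i : (0 : mxpull s N) i = 0.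
Proof. by rewrite ffunE. Qed.

Lemma mxpullBE (f g : mxpull s N) i : (f - g) i = f i - g i.
Proof. by rewrite !ffunE. Qed.

Lemma mxpull_sumE (K : Type) (r : seq K) (F : K -> mxpull s N) i :
  (\sum_(l <- r) F l) i = \sum_(l <- r) F l i.
Proof.
by elim/big_rec2: _ => [|l x y _ <-]; rewrite ?mxpull0E ?mxpullDE.
Qed.

Definition mxsingle (p : 'I_m) (x : N) : mxpull s N :=
  [ffun i => if i == p then x else 0].

Lemma mxsingleE p x i : mxsingle p x i = if i == p then x else 0.
Proof. by rewrite ffunE. Qed.

Lemma mxsingleD p : {morph mxsingle p : x y / x + y}.
Proof.
by move=> x y; apply/ffunP => i; rewrite !ffunE; case: eqP; rewrite ?addr0.
Qed.

End Lmod.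

Definition mxmap (M M' : lmodType R') (f : M -> M') (x : mxpull s M) :
  mxpull s M' := [ffun i => f (x i)].

Lemma mxmapE (M M' : lmodType R') (f : M -> M') (x : mxpull s M) i :
  mxmap f x i = f (x i).
Proof. by rewrite ffunE. Qed.

Lemma mxmap_linear (M M' : lmodType R') (f : M -> M') :
  linear f -> linear (mxmap f).
Proof.
move=> lf c x y; apply/ffunP => i; rewrite mxpullDE mxpullZE !mxmapE mxpullDE.
rewrite mxpullZE (linearfD lf) (linearf_sum lf); congr (_ + _).
by apply: eq_bigr => p _; rewrite mxmapE (linearfZ lf).
Qed.


Section Graded.
Variable N : graded_module G'.
Let gN := gm_grading N.

Definition mxpull_comp (j : int) : set (mxpull s N) :=
  [set f | forall i, gm_comp j (f i)].

Lemma mxpull_is_grading : is_grading mxpull_comp.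
Proof.
split=> [j i|j f g fj gj i|f|r c ur cP c0 j jr].
- by rewrite mxpull0E; apply: (gr_zero gN).
- by rewrite mxpullBE; apply: (gr_sub gN).
- have /choice[t tP] i := gprojP gN (f i).
  (* The supports of the m coordinates are merged into one list of degrees. *)
  pose u := undup (flatten [seq t i | i <- enum 'I_m]).
  exists u, (fun j => [ffun i => gproj gN (f i) j]); split.
    by move=> j _; split=> // i; rewrite ffunE; apply: gproj_comp.
  apply/ffunP => i; rewrite mxpull_sumE; under eq_bigr do rewrite ffunE.
  have [] := @gdecomp_widen _ _ _ _ _ _ u (tP i); rewrite ?undup_uniq //.
  move=> j jt; rewrite mem_undup; apply/flatten_mapP.
  by exists i; rewrite ?mem_enum.
- apply/ffunP => i; rewrite mxpull0E.
  apply: (gr_indep gN (c := fun j => c j i)) jr => //; last first.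
    by rewrite -mxpull_sumE c0 mxpull0E.
  by move=> l; apply: cP.
Qed.

Lemma mxpull_gm_scale (i : nat) (j : int) (a : R) (f : mxpull s N) :
  G i a -> mxpull_comp j f -> mxpull_comp (i%:Z + j) (a *: f).
Proof.
move=> Ga fj q; rewrite mxpullZE; elim/big_rec: _ => [|p x _ xN].
  exact: (gr_zero gN).
by apply: (grD gN) => //; apply: gm_scale => //; apply: mxhom_deg.
Qed.

Definition mxpull_gm : graded_module G :=
  GradedModule mxpull_is_grading mxpull_gm_scale.

Lemma mxpull_compP (j : int) (f : mxpull s N) :
  gm_comp (g := mxpull_gm) j f <-> forall i, gm_comp j (f i).
Proof. by []. Qed.

End Graded.

Lemma mxmap_hom (d : int) (M M' : graded_module G') (f : M -> M') :
  hom_deg d f -> hom_deg (M := mxpull_gm M) (N := mxpull_gm M') d (mxmap f).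
Proof.
move=> [lf df]; split=> [|i x xi]; first exact: mxmap_linear.
by apply/mxpull_compP => p; rewrite mxmapE; apply: df.
Qed.

End MxPull.

(** * Maps induced on truncations *)

Section MxTrunc.
Variables (R R' : pzRingType) (G : graded_ring R) (G' : graded_ring R').
Variables (m : nat) (s : mxhom G G' m) (n : nat).

Lemma mxhom_ge i j x : x \in ge_ideal G n -> s i j x \in ge_ideal G' n.
Proof.
move=> /asboolP; move: x.
apply: gsum_ind => [|x y hx hy|d x nd Gx].
- by rewrite mxhom0 rpred0.
- by rewrite mxhomD rpredD.
- by apply/asboolP/(gsum_homo nd)/mxhom_deg.
Qed.

Definition mxtrunc i j (x : trunc G n) : trunc G' n :=
  trunc_pi G' n (s i j (repr x)).

Lemma mxtrunc_pi i j x : mxtrunc i j (trunc_pi G n x) = trunc_pi G' n (s i j x).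
Proof.
apply/trunc_piE; rewrite -mxhomB; apply/mxhom_ge/trunc_piE.
exact: reprK.
Qed.

Lemma trunc_pi_sum (K : Type) (r : seq K) (F : K -> R') :
  trunc_pi G' n (\sum_(l <- r) F l) = \sum_(l <- r) trunc_pi G' n (F l).
Proof. by rewrite /trunc_pi raddf_sum. Qed.

Lemma mxtruncD i j : {morph mxtrunc i j : x y / x + y}.
Proof.
move=> x y; have [x' ->] := trunc_piK x; have [y' ->] := trunc_piK y.
by rewrite -trunc_piD !mxtrunc_pi mxhomD trunc_piD.
Qed.

Lemma mxtruncZ i j (a : R) x :
  mxtrunc i j (a *: x) = \sum_p s i p a *: mxtrunc p j x.
Proof.
have [y ->] := trunc_piK x; rewrite [a *: _]trunc_scale_pi mxtrunc_pi mxhomM.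
rewrite trunc_pi_sum; apply: eq_bigr => p _.
by rewrite mxtrunc_pi; exact/esym/trunc_scale_pi.
Qed.

(** Column p of the matrix; multiplicativity of [s] makes it linear for the action of R on the m-th
    power. *)
Definition mxtrunc_col p (x : trunc G n) : mxpull s (trunc G' n) :=
  [ffun i => mxtrunc i p x].

Lemma mxtrunc_col_hom p :
  hom_deg (M := trunc_gm G n) (N := mxpull_gm s (trunc_gm G' n)) 0 (mxtrunc_col p).
Proof.
split=> [c x y|i x xi].
  apply/ffunP => i; rewrite mxpullDE mxpullZE !ffunE mxtruncD mxtruncZ.
  by congr (_ + _); apply: eq_bigr => q _; rewrite ffunE.
apply/mxpull_compP => q; rewrite ffunE addr0.
case: i xi => i /=; last first.
  by move=> ->; exact: (morphD0 (@mxtruncD q p)).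
by move=> [y Gy <-]; rewrite mxtrunc_pi; exists (s q p y) => //; apply: mxhom_deg.
Qed.

End MxTrunc.

Section UHomMap.
Variables (R R' : pzRingType) (G : graded_ring R) (G' : graded_ring R').
Variables (M N : graded_module G) (M' N' : graded_module G').
Variables (F : (M -> N) -> M' -> N') (J : set int).
Hypotheses (F0 : F 0 = 0) (FD : {morph F : f g / f + g}).
Hypothesis F_hom : forall d f, hom_deg d f -> hom_deg d (F f).

Lemma uHom_map f : uHom J f -> uHom J (F f).
Proof.
move: f; apply: gsum_ind => [|f g hf hg|d f Jd hf].
- by rewrite F0; apply: gsum0.
- by rewrite FD; apply: uHomD.
- by apply: (gsum_homo Jd); apply: F_hom.
Qed.
End UHomMap.

Lemma hom_deg_comp (R : pzRingType) (G : graded_ring R) (d : int)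
    (M N P : graded_module G) (f : N -> P) (g : M -> N) :
  hom_deg d f -> hom_deg 0 g -> hom_deg d (f \o g).
Proof.
move=> [lf df] [lg dg]; split=> [c x y|i x xi] /=; first by rewrite lg lf.
by apply: df; rewrite -[i]addr0; apply: dg.
Qed.

(** * Transfer of condition chi along a bimodule free on both sides *)

Section Transfer.
Variables (R R' : pzRingType) (G : graded_ring R) (G' : graded_ring R').
Variables (m : nat) (s : mxhom G G' m) (w : mxhom G' G m).
(* A graded (R', R)-bimodule with homogeneous elements b_i of degree 0 forming a
   basis both over R' and over R: b_i a = \sum_p s_ip(a) b_p and
   x b_p = \sum_j b_j w_jp(x).  Then N |-> N^m is Hom over R' from the bimodule,
   and M |-> M^m is the tensor product with it over R. *)
Hypothesis sw : forall p q x, \sum_j s j q (w j p x) = x *+ (p == q).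
Hypothesis ws : forall i j a, \sum_p w j p (s i p a) = a *+ (i == j).

(** The adjoint of g: it sends the sum of the b_i (x) x_i to the sum of the values of g(x_i) at
    b_i. *)
Definition mxpull_adj (M : lmodType R) (N : lmodType R') (g : M -> mxpull s N)
  (x : mxpull w M) : N := \sum_i g (x i) i.

Lemma mxpull_adj_linear (M : lmodType R) (N : lmodType R') (g : M -> mxpull s N) :
  linear g -> linear (mxpull_adj g).
Proof.
move=> lg c x y; rewrite /mxpull_adj scaler_sumr.
under eq_bigr do rewrite mxpullDE (linearfD lg) mxpullDE mxpullZE
  (linearf_sum lg) mxpull_sumE.
rewrite big_split /=; congr (_ + _).
under eq_bigr => i _ do under eq_bigr => p _ do rewrite (linearfZ lg) mxpullZE.
rewrite exchange_big /=; apply: eq_bigr => p _.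
rewrite exchange_big /=; under eq_bigr do rewrite -scaler_suml sw.
rewrite (bigD1 p) //= eqxx big1 ?addr0 // => q qp.
by rewrite eq_sym (negPf qp) scale0r.
Qed.

(** The inverse adjunction x |-> (h(b_i (x) x))_i. By [ws], b_i (x) c x is the sum over p of s_ip(c)
    (b_p (x) x), which gives linearity over R. *)
Lemma mxpull_coadj_linear (M : lmodType R) (N : lmodType R') (h : mxpull w M -> N) :
  linear h -> linear (fun x : M => [ffun i => h (mxsingle w i x)] : mxpull s N).
Proof.
move=> lh c x y; apply/ffunP => i.
rewrite mxpullDE mxpullZE !ffunE mxsingleD (linearfD lh).
congr (_ + _); under eq_bigr do rewrite ffunE -(linearfZ lh).
rewrite -(linearf_sum lh); congr (h _); apply/ffunP => j.
rewrite mxsingleE mxpull_sumE.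
under eq_bigr => p _.
  rewrite mxpullZE (bigD1 p) //= mxsingleE eqxx big1 ?addr0; last first.
    by move=> q qp; rewrite mxsingleE (negPf qp) scaler0.
  over.
by rewrite /= -scaler_suml ws eq_sym; case: eqP; rewrite ?scale0r.
Qed.

Lemma mxpull_adj_hom (d : int) (M : graded_module G) (N : graded_module G')
    (g : M -> mxpull s N) :
  hom_deg (N := mxpull_gm s N) d g ->
  hom_deg (M := mxpull_gm w M) d (mxpull_adj g).
Proof.
move=> [lg dg]; split=> [|i x xi]; first exact: mxpull_adj_linear.
rewrite /mxpull_adj; elim/big_rec: _ => [|p y _ yE].
  exact: (gr_zero (gm_grading N)).
by apply: (grD (gm_grading N)) => //; apply: dg.
Qed.

(** The left adjoint M |-> M^m preserves injections, so the right adjoint preserves injectives: the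
    adjoint of g is extended along f^m and carried back. *)
Lemma mxpull_injective (E : graded_module G') :
  graded_injective E -> graded_injective (mxpull_gm s E).
Proof.
move=> injE M M' f g f_hom f_inj g_hom.
have [x y /ffunP xy||h [lh dh] hE] :=
    injE (mxpull_gm w M) _ _ (mxpull_adj g) (mxmap_hom w f_hom).
- by apply/ffunP => i; apply: f_inj; have := xy i; rewrite !ffunE.
- exact: mxpull_adj_hom.
exists (fun x => [ffun i => h (mxsingle w i x)]) => [|x].
  split=> [|i x xi]; first exact: mxpull_coadj_linear.
  apply/mxpull_compP => p; rewrite ffunE; apply: dh; apply/mxpull_compP => q.
  rewrite mxsingleE; case: eqP => // _.
  exact: (gr_zero (gm_grading M')).
apply/ffunP => i; rewrite ffunE.
have -> : mxsingle w i (f x) = mxmap f (mxsingle w i x).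
  apply/ffunP => j; rewrite !ffunE; case: eqP => // _.
  by rewrite (linearf0 f_hom.1).
rewrite hE /mxpull_adj (bigD1 i) //= mxsingleE eqxx big1 ?addr0 // => j ji.
by rewrite mxsingleE (negPf ji) (linearf0 g_hom.1) mxpull0E.
Qed.

Section Resolution.
Variables (N : graded_module G') (E : injective_resolution N).

(** Exactness is checked in each coordinate. The definition is transparent because its terms must
    unfold to powers of the terms of E. *)
Definition mxpull_resolution : injective_resolution (mxpull_gm s N).
Proof.
refine (@InjectiveResolution _ _ (mxpull_gm s N) (fun i => mxpull_gm s (E i))
  (mxmap (s := s) (@ires_aug _ _ _ E))
  (fun i => mxmap (s := s) (@ires_diff _ _ _ E i)) _ _ _ _ _ _).
- by move=> i; apply/mxpull_injective/ires_inj.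
- exact/mxmap_hom/ires_aug_hom.
- by move=> i; apply/mxmap_hom/ires_diff_hom.
- move=> x y /ffunP xy; apply/ffunP => i; apply: (@ires_aug_mono _ _ _ E).
  by have := xy i; rewrite !mxmapE.
- move=> x; split=> [/ffunP dx|[y ->]].
    have /choice[y yP] i : exists y, x i = ires_aug E y.
      by apply/ires_exact0; have := dx i; rewrite mxmapE mxpull0E.
    by exists [ffun i => y i]; apply/ffunP => i; rewrite mxmapE ffunE yP.
  apply/ffunP => i; rewrite !mxmapE mxpull0E; apply/ires_exact0.
  by exists (y i).
- move=> l x; split=> [/ffunP dx|[y ->]].
    have /choice[y yP] i : exists y, x i = ires_diff y.
      by apply/ires_exactS; have := dx i; rewrite mxmapE mxpull0E.
    by exists [ffun i => y i]; apply/ffunP => i; rewrite mxmapE ffunE yP.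
  apply/ffunP => i; rewrite !mxmapE mxpull0E; apply/ires_exactS.
  by exists (y i).
Defined.

End Resolution.

Section FinGen.
Variables (K : finType) (lam : K -> 'I_m -> 'I_m -> R').
Hypothesis s_gen : forall x, exists a : K -> R, forall i p,
  \sum_l \sum_q s i q (a l) * lam l q p = x *+ (i == p).

(** By [s_gen] each scalar matrix is a sum of products of s(a_l) with the matrix [lam l]. Hence, if
    the e_r generate N, applying the matrices [lam l] to e_r placed in coordinate p gives generators
    of N^m over R. *)
Lemma mxpull_fin_gen (N : lmodType R') :
  finitely_generated N -> finitely_generated (mxpull s N).
Proof.
move=> [n [e eP]].
pose X : finType := ('I_n * 'I_m * K)%type.
pose g (t : X) : mxpull s N := [ffun q => lam t.2 q t.1.2 *: e t.1.1].
exists #|X|, (fun t => g (enum_val t)) => v.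
have /choice[c cP] p := eP (v p).
have /choice[a aP] (t : 'I_n * 'I_m) := s_gen (c t.2 t.1).
exists (fun t => a (enum_val t).1 (enum_val t).2).
rewrite -(big_enum_val (fun t : X => a t.1 t.2 *: g t)) /=.
rewrite -(pair_bigA _ (fun (t : 'I_n * 'I_m) l => a t l *: g (t, l))) /=.
have -> : \sum_i \sum_l a i l *: g (i, l) =
    \sum_r \sum_p \sum_l a (r, p) l *: g (r, p, l).
  by rewrite [RHS]pair_bigA; apply: eq_bigr => -[].
apply/ffunP => i; rewrite mxpull_sumE (cP i); apply: eq_bigr => r _.
rewrite mxpull_sumE.
under eq_bigr => p _.
  rewrite mxpull_sumE.
  under eq_bigr => l _.
    rewrite mxpullZE; under eq_bigr do rewrite ffunE scalerA /=.
    rewrite -scaler_suml; over.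
  rewrite /= -scaler_suml aP /=; over.
rewrite /= (bigD1 i) //= eqxx big1 ?addr0 // => p pi.
by rewrite eq_sym (negPf pi) scale0r.
Qed.
End FinGen.

(** * The adjunction on cochains *)

Section Ext.
Variables (n : nat) (N : graded_module G') (E : injective_resolution N).
Variables (i : nat) (J : set int).

(** The bimodule tensored with R/R_(>= n) is m copies of R'/R'_(>= n), the p-th one embedded by y
    |-> y b_p, which is column p of [w]. This is the adjoint of f restricted to that copy. *)
Definition trunc_adj p (E' : lmodType R') (f : trunc G n -> mxpull s E') :
  trunc G' n -> E' := mxpull_adj f \o mxtrunc_col w p.

Lemma trunc_adjE p (E' : lmodType R') (f : trunc G n -> mxpull s E') x :
  trunc_adj p f x = \sum_j f (mxtrunc w j p x) j.
Proof. by apply: eq_bigr => j _; rewrite ffunE. Qed.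

Lemma trunc_adj_uHom p (E' : graded_module G') (L : set int)
    (f : trunc G n -> mxpull s E') :
  uHom (M := trunc_gm G n) (N := mxpull_gm s E') L f ->
  uHom (M := trunc_gm G' n) (N := E') L (trunc_adj p f).
Proof.
apply: (@uHom_map _ _ _ _ (trunc_gm G n) (mxpull_gm s E') (trunc_gm G' n) E'
  (@trunc_adj p E')) => [|f1 f2|d f1 hf].
- by apply/funext => x; rewrite trunc_adjE big1 // => j _; rewrite mxpull0E.
- apply/funext => x; rewrite [in RHS]addrfctE !trunc_adjE -big_split.
  by apply: eq_bigr => j _; rewrite addrfctE mxpullDE.
- apply: hom_deg_comp (mxtrunc_col_hom w n p).
  exact: mxpull_adj_hom hf.
Qed.

(** The R-linear map whose adjoint is f on the p-th copy and 0 on the others: s_jp(x) is the p-th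
    coordinate of b_j x. *)
Definition trunc_coadj p (E' : lmodType R') (f : trunc G' n -> E') :
  trunc G n -> mxpull s E' := mxmap f \o mxtrunc_col s p.

Lemma trunc_coadjE p (E' : lmodType R') (f : trunc G' n -> E') x j :
  trunc_coadj p f x j = f (mxtrunc s j p x).
Proof. by rewrite /trunc_coadj /= mxmapE ffunE. Qed.

Lemma trunc_coadj_uHom p (E' : graded_module G') (L : set int)
    (f : trunc G' n -> E') :
  uHom (M := trunc_gm G' n) L f ->
  uHom (M := trunc_gm G n) (N := mxpull_gm s E') L (trunc_coadj p f).
Proof.
apply: (@uHom_map _ _ _ _ (trunc_gm G' n) E' (trunc_gm G n) (mxpull_gm s E')
  (@trunc_coadj p E')) => [|f1 f2|d f1 hf].
- apply/funext => x; apply/ffunP => j; rewrite trunc_coadjE.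
  by rewrite [RHS](_ : _ = (0 : mxpull s E') j) ?mxpull0E.
- apply/funext => x; apply/ffunP => j.
  by rewrite [in RHS]addrfctE mxpullDE !trunc_coadjE.
- apply: hom_deg_comp (mxtrunc_col_hom s n p).
  exact: mxmap_hom hf.
Qed.

Lemma trunc_coadjK p (E' : lmodType R') (f : trunc G' n -> E') :
  linear f -> trunc_adj p (trunc_coadj p f) = f.
Proof.
move=> lf; apply/funext => x; rewrite trunc_adjE.
under eq_bigr do rewrite trunc_coadjE.
rewrite -(linearf_sum lf); congr (f _); have [y ->] := trunc_piK x.
under eq_bigr do rewrite mxtrunc_pi mxtrunc_pi.
by rewrite -trunc_pi_sum sw eqxx.
Qed.

(** Since b_p a = \sum_q s_pq(a) b_q, the action of a mixes the m components through row p of the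
    matrix s(a). *)
Lemma trunc_adj_act p (E' : lmodType R') (z : trunc G n -> mxpull s E') a x :
  linear z -> trunc_adj p (fun y => z (trunc_ract y a)) x =
  \sum_q trunc_adj q z (trunc_ract x (s p q a)).
Proof.
move=> lz; under [RHS]eq_bigr do rewrite trunc_adjE.
rewrite exchange_big trunc_adjE; apply: eq_bigr => j _ /=.
rewrite -mxpull_sumE -(linearf_sum lz); congr (z _ j).
have [y ->] := trunc_piK x.
rewrite mxtrunc_pi trunc_ract_pi.
under eq_bigr do rewrite trunc_ract_pi mxtrunc_pi mxhomM.
rewrite -trunc_pi_sum; congr trunc_pi; rewrite exchange_big /=.
under eq_bigr do rewrite -mulr_sumr ws.
rewrite (bigD1 p) //= eqxx big1 ?addr0 // => q qp.
by rewrite eq_sym (negPf qp) mulr0.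
Qed.

Lemma trunc_adj_cocycle p (f : trunc G n -> mxpull s (E i)) :
  ext_cocycle (M := trunc_gm G n) (E := mxpull_resolution E) J f ->
  ext_cocycle (M := trunc_gm G' n) (E := E) J (trunc_adj p f).
Proof.
move=> [Jf df]; split=> [|x]; first exact: trunc_adj_uHom.
have ld := (ires_diff_hom E i).1.
rewrite trunc_adjE (linearf_sum ld) big1 // => j _.
by have /ffunP/(_ j) := df (mxtrunc w j p x); rewrite /= mxmapE mxpull0E.
Qed.

Lemma trunc_coadj_cocycle p (f : trunc G' n -> E i) :
  ext_cocycle (M := trunc_gm G' n) (E := E) J f ->
  ext_cocycle (M := trunc_gm G n) (E := mxpull_resolution E) J (trunc_coadj p f).
Proof.
move=> [Jf df]; split=> [|x]; first exact: trunc_coadj_uHom.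
by apply/ffunP => j; rewrite /= mxmapE trunc_coadjE df mxpull0E.
Qed.

End Ext.

Lemma trunc_adj_coboundary n (N : graded_module G') (E : injective_resolution N)
    i p (f : trunc G n -> mxpull s (E i)) :
  ext_coboundary (M := trunc_gm G n) (E := mxpull_resolution E) f ->
  ext_coboundary (M := trunc_gm G' n) (E := E) (trunc_adj p f).
Proof.
case: i f => [|i] f /=.
  by move=> ->; apply/funext => x; rewrite trunc_adjE big1 // => j _; rewrite mxpull0E.
move=> [g hg ->]; exists (trunc_adj p g); first exact: trunc_adj_uHom.
have ld := (ires_diff_hom E i).1.
apply/funext => x; rewrite !trunc_adjE (linearf_sum ld).
by apply: eq_bigr => j _; rewrite mxmapE.
Qed.

(** All components of the generators over R generate over R': a cocycle f is placed in the p-th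
    copy, expanded there up to a coboundary, and recovered as the p-th component. *)
Lemma mxpull_ext_fin_gen n (N : graded_module G') (E : injective_resolution N)
    i d (p : 'I_m) :
  ext_ge_fin_gen (M := trunc_gm G n) (@trunc_ract R G n) (mxpull_resolution E) i d ->
  ext_ge_fin_gen (M := trunc_gm G' n) (@trunc_ract R' G' n) E i d.
Proof.
move=> [l [z [zP z_gen]]].
pose X : finType := ('I_l * 'I_m)%type.
exists #|X|, (fun t => trunc_adj (enum_val t).2 (z (enum_val t).1)).
split=> [t|f fP]; first exact: trunc_adj_cocycle.
have [a aP] := z_gen _ (trunc_coadj_cocycle p fP).
(* By [trunc_adj_act] the q-th component of z_r enters with coefficient s_pq(a_r). *)
exists (fun t => s p (enum_val t).2 (a (enum_val t).1)).
have := trunc_adj_coboundary p aP; congr (ext_coboundary _).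
apply/funext => x.
rewrite -(big_enum_val (fun t : X => ext_act (M := trunc_gm G' n)
  (@trunc_ract R' G' n) (E := E) (s p t.2 (a t.1)) (trunc_adj t.2 (z t.1)))) /=.
rewrite -(pair_bigA _ (fun r q => ext_act (M := trunc_gm G' n)
  (@trunc_ract R' G' n) (E := E) (s p q (a r)) (trunc_adj q (z r)))) /=.
have lf : linear f := uHom_linear fP.1.
rewrite -{2}(trunc_coadjK p lf).
have adjB (f1 f2 : trunc G n -> mxpull s (E i)) :
    trunc_adj p (f1 - f2) x = trunc_adj p f1 x - trunc_adj p f2 x.
  rewrite !trunc_adjE -sumrB; apply: eq_bigr => j _.
  by rewrite addrfctE opprfctE mxpullBE.
have adj_sum (F : 'I_l -> trunc G n -> mxpull s (E i)) :
    trunc_adj p (\sum_r F r) x = \sum_r trunc_adj p (F r) x.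
  rewrite trunc_adjE; under eq_bigr do rewrite fct_sumE mxpull_sumE.
  by rewrite exchange_big; apply: eq_bigr => r _; rewrite trunc_adjE.
rewrite adjB adj_sum [in RHS]addrfctE opprfctE; congr (_ - _).
rewrite [in RHS]fct_sumE; apply: eq_bigr => r _.
rewrite [in RHS]fct_sumE; apply: trunc_adj_act.
exact: uHom_linear (zP r).1.
Qed.

(** The bound [n0] obtained for N^m over R serves for N over R'. The index [p] records that m is
    positive, so that N^m has a component to read off. *)
Lemma condition_chi_transfer (K : finType) (lam : K -> 'I_m -> 'I_m -> R')
    (p : 'I_m) :
  (forall x, exists a : K -> R, forall i p,
     \sum_l \sum_q s i q (a l) * lam l q p = x *+ (i == p)) ->
  condition_chi G -> condition_chi G'.
Proof.
move=> s_gen chiG _ i d N fgN.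
have [n0 n0P] := chiG i d (mxpull_gm s N) (mxpull_fin_gen s_gen fgN).
by exists n0 => n /n0P h E; apply/(mxpull_ext_fin_gen p)/h.
Qed.

End Transfer.

(** * Coordinates in tensor products *)

Section Basis.
Variables (k : fieldType) (V : lmodType k).

(** A generating family of least size is free: a nontrivial relation would let one generator be
    eliminated. *)
Lemma fin_gen_basis : finitely_generated V ->
  exists (m : nat) (e : 'I_m -> V) (c : 'I_m -> {linear V -> k^o}),
    (forall v, v = \sum_i c i v *: e i) /\
    (forall i j, c i (e j) = (i == j)%:R).
Proof.
move=> fgV; pose P m := `[< exists e : 'I_m -> V,
  forall v, exists c : 'I_m -> k, v = \sum_i c i *: e i >].
have exP : exists m, P m by have [m h] := fgV; exists m; apply/asboolP.
have [m /asboolP[e eP] m_min] := ex_minnP exP.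
have free (c : 'I_m -> k) : \sum_i c i *: e i = 0 -> forall i, c i = 0.
  move=> c0 i; apply: contrapT => /eqP ci.
  case: m => [|m] in e eP m_min c c0 i ci *; first by case: i ci.
  have /m_min : P m; last by rewrite ltnn.
  apply/asboolP; exists (fun l => e (lift i l)) => v.
  have [d ->] := eP v; rewrite (bigD1_ord i) //= in c0 *.
  (* The relation is solved for [e i], whose coefficient is invertible. *)
  exists (fun l => d (lift i l) - d i * (c i)^-1 * c (lift i l)).
  under [RHS]eq_bigr do rewrite scalerBl -scalerA.
  rewrite sumrB -scaler_sumr (bigD1_ord i) //= addrC; congr (_ + _).
  move/eqP: c0; rewrite addrC addr_eq0 => /eqP->.
  by rewrite scalerN opprK scalerA mulfVK.
have /choice[c cP] := eP.
have cE v d : v = \sum_i d i *: e i -> c v = d.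
  move=> vE; apply/funext => i; apply/eqP; rewrite -subr_eq0; apply/eqP.
  apply: (free (fun i => c v i - d i)).
  by under eq_bigr do rewrite scalerBl; rewrite sumrB -cP -vE subrr.
have lc i : linear (fun v => c v i : k^o).
  move=> a x y; rewrite (cE _ (fun j => a *: (c x j : k^o) + c y j)) //.
  under eq_bigr do rewrite scalerDl -scalerA.
  by rewrite big_split -scaler_sumr -!cP.
pose C i : {linear V -> k^o} :=
  HB.pack (fun v => c v i : k^o) (GRing.isLinear.Build k V k^o *:%R _ (lc i)).
exists m, e, C; split=> // i j /=.
rewrite (cE _ (fun l => (l == j)%:R)) // (bigD1 j) //= eqxx scale1r.
by rewrite big1 ?addr0 // => l lj; rewrite (negPf lj) scale0r.
Qed.

End Basis.

Section TensorLinear.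
Variable k : fieldType.

HB.instance Definition _ (V W V' W' : lmodType k) (f : {linear V -> V'})
    (g : {linear W -> W'}) :=
  GRing.isLinear.Build k (V ⊗ W) (V' ⊗ W') *:%R (tmap f g)
    (tmap_linear (linearP f) (linearP g)).

HB.instance Definition _ (U V W : lmodType k) :=
  GRing.isLinear.Build k ((U ⊗ V) ⊗ W) (U ⊗ (V ⊗ W)) *:%R
    (@tassoc k U V W) (@tassoc_linear k U V W).

Lemma pure_linear (V W : lmodType k) (v : V) : linear (pure v : W -> V ⊗ W).
Proof. by move=> c x y; rewrite pureDr pureZr. Qed.

HB.instance Definition _ (V W : lmodType k) (v : V) :=
  GRing.isLinear.Build k W (V ⊗ W) *:%R (pure v) (@pure_linear V W v).

Definition rpure (V W : lmodType k) (w : W) (v : V) : V ⊗ W := v \ot w.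

Lemma rpure_linear (V W : lmodType k) (w : W) : linear (@rpure V W w).
Proof. by move=> c x y; rewrite /rpure pureDl pureZl. Qed.

HB.instance Definition _ (V W : lmodType k) (w : W) :=
  GRing.isLinear.Build k V (V ⊗ W) *:%R (rpure w) (@rpure_linear V W w).

(** Multiplications are named so that they can carry a linear structure and serve as factors of
    [tmap]. *)
Definition lmul (A : pzAlgType k) (a b : A) : A := a * b.
Definition rmul (A : pzAlgType k) (a b : A) : A := b * a.

Lemma lmul_linear (A : pzAlgType k) (a : A) : linear (lmul a).
Proof. by move=> c x y; rewrite /lmul mulrDr pzscalerAr. Qed.

Lemma rmul_linear (A : pzAlgType k) (a : A) : linear (rmul a).
Proof. by move=> c x y; rewrite /rmul mulrDl pzscalerAl. Qed.

HB.instance Definition _ (A : pzAlgType k) (a : A) :=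
  GRing.isLinear.Build k A A *:%R (lmul a) (lmul_linear a).

HB.instance Definition _ (A : pzAlgType k) (a : A) :=
  GRing.isLinear.Build k A A *:%R (rmul a) (rmul_linear a).

Lemma mulmap_bilinear (A : pzAlgType k) :
  bilinear_for *:%R *:%R (fun a b : A => a * b).
Proof.
split=> [b c x y|a c x y] /=; first by rewrite mulrDl pzscalerAl.
by rewrite mulrDr pzscalerAr.
Qed.

HB.instance Definition _ (A : pzAlgType k) :=
  GRing.isLinear.Build k (A ⊗ A) A *:%R (@mulmap k A)
    (tlift_linear (mulmap_bilinear A)).

Lemma mulmap_pure (A : pzAlgType k) (a b : A) : mulmap (a \ot b) = a * b.
Proof. exact: tlift_pure (mulmap_bilinear A). Qed.

Lemma tens_linext (V W U : lmodType k) (f g : {linear V ⊗ W -> U}) :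
  (forall v w, f (v \ot w) = g (v \ot w)) -> f =1 g.
Proof. by apply: tens_ext => x y; rewrite linearD. Qed.

Lemma tmapE (V W V' W' : lmodType k) (f : {linear V -> V'})
  (g : {linear W -> W'}) v w : tmap f g (v \ot w) = f v \ot g w.
Proof. by rewrite tmap_pure //; apply: linearP. Qed.

Lemma tmap_comp (V W V' W' V'' W'' : lmodType k)
    (f : {linear V -> V'}) (g : {linear W -> W'})
    (f' : {linear V' -> V''}) (g' : {linear W' -> W''}) x :
  tmap f' g' (tmap f g x) = tmap (f' \o f) (g' \o g) x.
Proof.
rewrite -[LHS]/((tmap f' g' \o tmap f g) x); move: x; apply: tens_linext => v w.
by rewrite /= !tmapE.
Qed.

Lemma tmap_sumr (V W V' W' : lmodType k) (K : Type) (r : seq K)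
    (f : {linear V -> V'}) (g : {linear W -> W'}) (G : K -> {linear W -> W'}) x :
  (forall w, g w = \sum_(l <- r) G l w) ->
  tmap f g x = \sum_(l <- r) tmap f (G l) x.
Proof.
move=> gE; elim/tens_ind: x => [|x y hx hy|v w].
- by rewrite linear0 big1 // => l _; rewrite linear0.
- rewrite linearD /= hx hy -big_split; apply: eq_bigr => l _.
  by rewrite linearD.
- rewrite tmapE gE linear_sum; apply: eq_bigr => l _.
  by rewrite tmapE.
Qed.

Lemma tassoc_tmap (U V W U' V' W' : lmodType k) (f : {linear U -> U'})
    (g : {linear V -> V'}) (h : {linear W -> W'}) x :
  tassoc (tmap (tmap f g) h x) = tmap f (tmap g h) (tassoc x).
Proof.
rewrite -[LHS]/((@tassoc _ _ _ _ \o tmap (tmap f g) h) x).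
rewrite -[RHS]/((tmap f (tmap g h) \o @tassoc _ _ _ _) x).
move: x; apply: tens_linext => y w /=; rewrite tmapE /=.
elim/tens_ind: y => [|x y hx hy|u v].
- by rewrite linear0 !pure0l !linear0.
- by rewrite linearD !pureDl !linearD /= hx hy.
- by rewrite tmapE !tassoc_pure !tmapE /= tmapE.
Qed.

Lemma tmap_id (V W : lmodType k) (x : V ⊗ W) : tmap idfun idfun x = x.
Proof.
rewrite -[RHS]/(idfun x); move: x; apply: tens_linext => v w; exact: tmapE.
Qed.

Lemma tmap_idK (V W W' : lmodType k) (f : {linear W -> W'})
    (g : {linear W' -> W}) : cancel f g -> cancel (tmap (@idfun V) f) (tmap idfun g).
Proof.
by move=> fK x; rewrite tmap_comp -[RHS]tmap_id; congr tmap; apply/funext.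
Qed.

Lemma mul_tmap (A B : pzAlgType k) (a : A) (b : B) (x : A ⊗ B) :
  x * (a \ot b) = tmap (rmul a) (rmul b) x.
Proof.
elim/tens_ind: x => [|x y hx hy|a' b']; first by rewrite mul0r linear0.
  by rewrite mulrDl hx hy linearD.
by rewrite tmapE mul_pure.
Qed.

Lemma tmap_lmul (A B : pzAlgType k) (a : A) (b : B) (x : A ⊗ B) :
  (a \ot b) * x = tmap (lmul a) (lmul b) x.
Proof.
elim/tens_ind: x => [|x y hx hy|a' b']; first by rewrite mulr0 linear0.
  by rewrite mulrDr hx hy linearD.
by rewrite tmapE mul_pure.
Qed.

End TensorLinear.

Section Coordinates.
Variables (k : fieldType) (W : lmodType k) (m : nat).
Variables (t : 'I_m -> W) (c : 'I_m -> {linear W -> k^o}).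

Section Tcoord.
Variable V : lmodType k.

(** When t is a basis of W with dual family c, these are the V-valued coordinates that identify V
    (x) W with V^m. *)
Definition tcoord i (x : V ⊗ W) : V := tlift (fun v w => (c i w : k) *: v) x.

Lemma tcoord_bilinear i :
  bilinear_for *:%R *:%R (fun (v : V) (w : W) => (c i w : k) *: v).
Proof.
split=> [w a x y|v a x y] /=.
  by rewrite scalerDr !scalerA mulrC.
by rewrite linearP scalerDl scalerA.
Qed.

HB.instance Definition _ i := GRing.isLinear.Build k (V ⊗ W) V *:%R
  (tcoord i) (tlift_linear (tcoord_bilinear i)).

Lemma tcoordE i v w : tcoord i (v \ot w) = (c i w : k) *: v.
Proof. exact: tlift_pure (tcoord_bilinear i). Qed.

Hypothesis tc : forall w, w = \sum_i (c i w : k) *: t i.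

Lemma tcoord_sum x : x = \sum_i tcoord i x \ot t i.
Proof.
elim/tens_ind: x => [|x y hx hy|v w].
- by rewrite big1 // => i _; rewrite linear0 pure0l.
- rewrite {1}hx {1}hy -big_split; apply: eq_bigr => i _.
  by rewrite linearD pureDl.
- rewrite {1}[w]tc linear_sum; apply: eq_bigr => i _.
  by rewrite tcoordE pureZl linearZ.
Qed.

Hypothesis ct : forall i j, c i (t j) = (i == j)%:R.

Lemma tcoord_basis i j v : tcoord i (v \ot t j) = v *+ (i == j).
Proof. by rewrite tcoordE ct scaler_nat. Qed.
End Tcoord.

Lemma tcoord_tmap (V V' : lmodType k) (f : {linear V -> V'}) i x :
  tcoord i (tmap f idfun x) = f (tcoord i x).
Proof.
rewrite -[LHS]/((tcoord i \o tmap f idfun) x) -[RHS]/((f \o tcoord i) x).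
move: x; apply: tens_linext => v w.
by rewrite /= tmapE !tcoordE linearZ.
Qed.

Lemma tcoord_tassoc (U V : lmodType k) i (x : (U ⊗ V) ⊗ W) :
  tmap idfun (tcoord i) (tassoc x) = tcoord i x.
Proof.
rewrite -[LHS]/((tmap idfun (tcoord i) \o @tassoc _ _ _ _) x).
move: x; apply: tens_linext => y w /=; rewrite tcoordE.
elim/tens_ind: y => [|x y hx hy|u v].
- by rewrite pure0l !linear0.
- by rewrite pureDl !linearD /= hx hy.
- by rewrite tassoc_pure tmapE /= tcoordE pureZr.
Qed.

End Coordinates.

(** * The translation map of a torsor *)

Section Torsor.
Variables (k : fieldType) (H : pzAlgType k) (hH : hopf_algebra H).
Variables (T : pzAlgType k) (rho : left_comodule_algebra hH T).

Lemma torsor_map_linear : linear (torsor_map rho).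
Proof. by move=> a x y; rewrite /torsor_map !linearP. Qed.

HB.instance Definition _ := GRing.isLinear.Build k (T ⊗ T) (H ⊗ T) *:%R
  (torsor_map rho) torsor_map_linear.

Lemma torsor_map_inverse : bijective (torsor_map rho) ->
  exists2 b : {linear H ⊗ T -> T ⊗ T},
    cancel (torsor_map rho) b & cancel b (torsor_map rho).
Proof.
case=> b bK Kb; have lb : linear b.
  by move=> a x y; apply: (can_inj bK); rewrite Kb linearP /= !Kb.
pose bl : {linear H ⊗ T -> T ⊗ T} :=
  HB.pack b (GRing.isLinear.Build k (H ⊗ T) (T ⊗ T) *:%R b lb).
by exists bl.
Qed.

Lemma torsor_map_pure u s :
  torsor_map rho (u \ot s) = tmap idfun (rmul s) (rho u).
Proof.
rewrite /torsor_map tmapE /=; elim/tens_ind: (rho u) => [|x y hx hy|h v].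
- by rewrite pure0l !linear0.
- by rewrite pureDl !linearD /= hx hy.
- by rewrite tassoc_pure !tmapE /= mulmap_pure.
Qed.

Lemma torsor_map_rmul s y :
  torsor_map rho (tmap idfun (rmul s) y) = tmap idfun (rmul s) (torsor_map rho y).
Proof.
rewrite -[LHS]/((torsor_map rho \o tmap idfun (rmul s)) y).
rewrite -[RHS]/((tmap idfun (rmul s) \o torsor_map rho) y).
move: y; apply: tens_linext => u v /=.
rewrite tmapE /= !torsor_map_pure tmap_comp; congr tmap.
by apply/funext => x; rewrite /= /rmul mulrA.
Qed.

Lemma counit_bilinear (V : lmodType k) :
  bilinear_for *:%R *:%R (fun (h : H) (x : V) => (counit hH h : k) *: x).
Proof.
split=> [x a g h|h a x y] /=; first by rewrite linearP scalerDl scalerA.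
by rewrite scalerDr !scalerA mulrC.
Qed.

Lemma counit_torsor_map y :
  tlift (fun (h : H) (x : T) => (counit hH h : k) *: x) (torsor_map rho y) =
  mulmap y.
Proof.
have ll := tlift_linear (counit_bilinear T).
elim/tens_ind: y => [|x y hx hy|u s].
- by rewrite !linear0 (lin0 ll).
- by rewrite !linearD (linD ll) /= hx hy.
- rewrite torsor_map_pure mulmap_pure -[in RHS](lcoact1 rho u).
  elim/tens_ind: (rho u) => [|x y hx hy|h v].
  + by rewrite linear0 !(lin0 ll) mul0r.
  + by rewrite linearD !(linD ll) mulrDl /= hx hy.
  + by rewrite tmapE !(tlift_pure _ _ (counit_bilinear T)) pzscalerAl.
Qed.

(** The coaction of H on T (x) T through the first factor. *)
Definition lcoact2 (y : T ⊗ T) : H ⊗ (T ⊗ T) := tassoc (tmap rho idfun y).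

Lemma lcoact2_linear : linear lcoact2.
Proof. by move=> a x y; rewrite /lcoact2 !linearP. Qed.

HB.instance Definition _ := GRing.isLinear.Build k (T ⊗ T) (H ⊗ (T ⊗ T)) *:%R
  lcoact2 lcoact2_linear.

Lemma lcoact2_pure u s : lcoact2 (u \ot s) = tmap idfun (rpure s) (rho u).
Proof.
rewrite /lcoact2 tmapE /=; elim/tens_ind: (rho u) => [|x y hx hy|h v].
- by rewrite pure0l !linear0.
- by rewrite pureDl !linearD /= hx hy.
- by rewrite tassoc_pure !tmapE.
Qed.

(** Coassociativity of [rho] says that the torsor map is colinear, H (x) T carrying the coaction of
    its factor H. *)
Lemma lcoact2_torsor_map y :
  tmap idfun (torsor_map rho) (lcoact2 y) =
  tassoc (tmap (comul hH) idfun (torsor_map rho y)).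
Proof.
rewrite -[LHS]/((tmap idfun (torsor_map rho) \o lcoact2) y).
rewrite -[RHS]/((@tassoc _ _ _ _ \o (tmap (comul hH) idfun \o torsor_map rho)) y).
move: y; apply: tens_linext => u s /=.
rewrite lcoact2_pure torsor_map_pure !tmap_comp.
rewrite (_ : tmap (comul hH \o _) _ = tmap (comul hH) (rmul s)) //.
have -> : tmap (comul hH) (rmul s) (rho u) =
  tmap (tmap idfun idfun) (rmul s) (tmap (comul hH) idfun (rho u)).
  by rewrite tmap_comp; congr tmap; apply/funext => x; rewrite /= tmap_id.
rewrite tassoc_tmap lcoactA tmap_comp; congr tmap.
by apply/funext => x; rewrite /= torsor_map_pure.
Qed.

Variable bi : {linear H ⊗ T -> T ⊗ T}.
Hypotheses (biK : cancel (torsor_map rho) bi) (Kbi : cancel bi (torsor_map rho)).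
Variables (m : nat) (t : 'I_m -> T) (c : 'I_m -> {linear T -> k^o}).
Hypothesis tc : forall w, w = \sum_i (c i w : k) *: t i.
Hypothesis ct : forall i j, c i (t j) = (i == j)%:R.

(** The inverse torsor map in coordinates: it sends h (x) s to the sum of the [transl s p h] (x)
    t_p. *)
Definition transl (s : T) p (h : H) : T := tcoord c p (bi (h \ot s)).

Lemma transl_linear s p : linear (transl s p).
Proof.
by move=> a x y; rewrite /transl pureDl pureZl !linearP.
Qed.

HB.instance Definition _ s p := GRing.isLinear.Build k H T *:%R
  (transl s p) (transl_linear s p).

Lemma transl_counit s h : \sum_p transl s p h * t p = (counit hH h : k) *: s.
Proof.
have := counit_torsor_map (bi (h \ot s)).
rewrite Kbi (tlift_pure _ _ (counit_bilinear T)) => ->.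
rewrite [in RHS](tcoord_sum tc (bi _)) linear_sum.
by apply: eq_bigr => p _; rewrite /= mulmap_pure.
Qed.

(** The inverse of a colinear bijection is colinear, and taking coordinates in the second factor
    preserves this. *)
Lemma transl_coact s p h :
  rho (transl s p h) = tmap idfun (transl s p) (comul hH h).
Proof.
have := congr1 (tmap idfun bi) (lcoact2_torsor_map (bi (h \ot s))).
rewrite (tmap_idK biK) Kbi tmapE /=.
move=> /(congr1 (tmap idfun (tcoord c p))).
rewrite {1}/lcoact2 tcoord_tassoc tcoord_tmap => ->.
elim/tens_ind: (comul hH h) => [|x y hx hy|g g'].
- by rewrite pure0l !linear0.
- by rewrite pureDl !linearD /= hx hy.
- by rewrite tassoc_pure !tmapE.
Qed.

Lemma bi_rmul s y : bi (tmap idfun (rmul s) y) = tmap idfun (rmul s) (bi y).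
Proof. by rewrite -{1}[y]Kbi -torsor_map_rmul biK. Qed.

(** * The Hopf module T (x) T^op *)

Definition tau (h : H) : T ⊗ T := bi (h \ot (1 : T)).

Lemma tau_linear : linear tau.
Proof. by move=> a x y; rewrite /tau pureDl pureZl linearP. Qed.

(* The left multiplication by tau h in T (x) T^op. *)
Definition tact (h : H) (y : T ⊗ T) : T ⊗ T :=
  \sum_p tmap (lmul (transl 1 p h)) (rmul (t p)) y.

Lemma tact_linear h : linear (tact h).
Proof.
move=> a x y; rewrite /tact scaler_sumr -big_split.
by apply: eq_bigr => p _; rewrite linearP.
Qed.

HB.instance Definition _ h := GRing.isLinear.Build k (T ⊗ T) (T ⊗ T) *:%R
  (tact h) (tact_linear h).

Lemma tact_pure h u s : tact h (u \ot s) = tmap (rmul u) (lmul s) (tau h).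
Proof.
rewrite [in RHS](tcoord_sum tc (tau h)) linear_sum.
by apply: eq_bigr => p _; rewrite /= !tmapE.
Qed.

Lemma tact_linearl y : linear (tact^~ y).
Proof.
move=> a g h; elim/tens_ind: y => [|x y hx hy|u s].
- by rewrite !linear0 addr0.
- by rewrite !(linearD (tact _)) /= hx hy scalerDr addrACA.
- by rewrite !tact_pure tau_linear linearP.
Qed.

Lemma torsor_map_tact h y : torsor_map rho (tact h y) =
  \sum_p (rho (transl 1 p h) : tens H T) * (torsor_map rho y : tens H T) * ((1 : H) \ot t p).
Proof.
rewrite /tact linear_sum; apply: eq_bigr => p _ /=.
elim/tens_ind: y => [|x y hx hy|u s].
- by rewrite !linear0 mulr0 mul0r.
- by rewrite !linearD /= hx hy mulrDr mulrDl.
- rewrite tmapE /= !torsor_map_pure mul_tmap (lcoact_morphism rho).2.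
  have E v (x : H ⊗ T) : tmap idfun (rmul v) x = (x : tens H T) * ((1 : H) \ot v).
    rewrite mul_tmap; congr tmap; apply/funext => g /=.
    by rewrite /rmul mulr1.
  by rewrite !E -mul_tmap -!mulrA mul_pure mulr1.
Qed.

(** [tau] is multiplicative into T (x) T^op: both sides have the same image under the torsor map,
    because h (x) 1 commutes with 1 (x) t_p. *)
Lemma tau_mul g h : tau (g * h) = tact g (tau h).
Proof.
apply: (can_inj biK); rewrite torsor_map_tact /tau !Kbi.
have /(congr1 (torsor_map rho)) := tcoord_sum tc (bi (g \ot (1 : T))).
rewrite Kbi linear_sum /= => /(congr1 (fun z : tens H T => z * (h \ot (1 : T)))).
rewrite mul_pure mulr1 => ->; rewrite mulr_suml; apply: eq_bigr => p _.
rewrite torsor_map_pure -mulrA mul_pure mulr1 mul1r.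
by rewrite !mul_tmap tmap_comp; congr tmap; apply/funext => x; rewrite /= /rmul mulr1.
Qed.

Lemma tactM g h y : tact (g * h) y = tact g (tact h y).
Proof.
elim/tens_ind: y => [|x y hx hy|u s]; first by rewrite !linear0.
  by rewrite !linearD /= hx hy.
rewrite !tact_pure tau_mul; elim/tens_ind: (tau h) => [|x y hx hy|x y].
- by rewrite !linear0.
- by rewrite !linearD /= hx hy.
- rewrite tmapE !tact_pure !tmap_comp; congr tmap; apply/funext => z /=.
    by rewrite /rmul mulrA.
  by rewrite /lmul mulrA.
Qed.

Lemma tact1 y : tact 1 y = y.
Proof.
have tau1 : tau 1 = (1 : T) \ot (1 : T).
  apply: (can_inj biK); rewrite Kbi torsor_map_pure (lcoact_morphism rho).1.
  by rewrite one_pure tmapE /= /rmul mulr1.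
elim/tens_ind: y => [|x y hx hy|u s]; first by rewrite linear0.
  by rewrite linearD /= hx hy.
by rewrite tact_pure tau1 tmapE /= /rmul /lmul mul1r mulr1.
Qed.

(** The Hopf module axiom, for any presentation of the comultiplication of h. It rests on [rho]
    being multiplicative and [transl] colinear. *)
Lemma lcoact2_tact (K : Type) (r : seq K) h (g g' : K -> H) y :
  comul hH h = \sum_(l <- r) g l \ot g' l ->
  lcoact2 (tact h y) = \sum_(l <- r) tmap (lmul (g l)) (tact (g' l)) (lcoact2 y).
Proof.
move=> hE; elim/tens_ind: y => [|x y hx hy|u s].
- by rewrite !linear0 big1 // => l _; rewrite !linear0.
- rewrite !linearD /= hx hy -big_split; apply: eq_bigr => l _.
  by rewrite [RHS]linearD.
rewrite lcoact2_pure linear_sum.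
under [RHS]eq_bigr => l _.
  rewrite tmap_comp (@tmap_sumr _ _ _ _ _ _ (index_enum 'I_m) _ _
    (fun p => rpure (s * t p) \o lmul (transl 1 p (g' l)))); last first.
    by move=> v /=; apply: eq_bigr => p _; rewrite /rpure tmapE.
  over.
rewrite exchange_big /=; apply: eq_bigr => p _.
rewrite tmapE /= lcoact2_pure /= (lcoact_morphism rho).2 transl_coact hE.
rewrite (linear_sum (tmap idfun (transl 1 p))) mulr_suml (linear_sum (tmap _ _)).
apply: eq_bigr => l _ /=.
by rewrite tmapE tmap_lmul tmap_comp.
Qed.

(** * Matrix coefficients of the coaction and coinvariants *)

(** The matrix of the comodule T in the basis t. Comultiplication becomes the matrix product, the
    counit gives the identity matrix and the antipode the inverse matrix. *)
Definition mcoef i p : H := tcoord c p (rho (t i)).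

Lemma lcoact_mcoef i : rho (t i) = \sum_p mcoef i p \ot t p.
Proof. exact: (tcoord_sum tc). Qed.

Lemma comul_mcoef i p : comul hH (mcoef i p) = \sum_q mcoef i q \ot mcoef q p.
Proof.
have := congr1 (tmap idfun (tcoord c p)) (lcoactA rho (t i)).
rewrite tcoord_tassoc tcoord_tmap => ->; rewrite lcoact_mcoef.
rewrite (linear_sum (tmap idfun rho)) (linear_sum (tmap _ _)).
by apply: eq_bigr => q _; rewrite /= !tmapE.
Qed.

Lemma counit_mcoef i p : counit hH (mcoef i p) = (i == p)%:R.
Proof.
have /(congr1 (c p)) := lcoact1 rho (t i).
have ll := tlift_linear (counit_bilinear T).
rewrite lcoact_mcoef (big_morph _ (linD ll) (lin0 ll)) linear_sum ct eq_sym => <-.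
rewrite (bigD1 p) //= (tlift_pure _ _ (counit_bilinear T)) linearZ ct eqxx.
rewrite big1 ?addr0 => [|q qp]; first by rewrite /= [_ *: _]mulr1.
rewrite (tlift_pure _ _ (counit_bilinear T)) linearZ ct eq_sym (negPf qp).
exact: scaler0.
Qed.

Lemma antipode_mcoefl i p :
  \sum_q antipode hH (mcoef i q) * mcoef q p = (i == p)%:R.
Proof.
have bil : bilinear_for *:%R *:%R (fun a b : H => antipode hH a * b).
  split=> [b a x y|a b x y] /=; first by rewrite linearP mulrDl pzscalerAl.
  by rewrite mulrDr pzscalerAr.
have := antipodel hH (mcoef i p); rewrite counit_mcoef scaler_nat => <-.
rewrite comul_mcoef (big_morph _ (linD (tlift_linear bil)) (lin0 (tlift_linear bil))).
by apply: eq_bigr => q _; rewrite (tlift_pure _ _ bil).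
Qed.

Lemma antipode_mcoefr i p :
  \sum_q mcoef i q * antipode hH (mcoef q p) = (i == p)%:R.
Proof.
have bil : bilinear_for *:%R *:%R (fun a b : H => a * antipode hH b).
  split=> [b a x y|a b x y] /=; first by rewrite mulrDl pzscalerAl.
  by rewrite linearP mulrDr pzscalerAr.
have := antipoder hH (mcoef i p); rewrite counit_mcoef scaler_nat => <-.
rewrite comul_mcoef (big_morph _ (linD (tlift_linear bil)) (lin0 (tlift_linear bil))).
by apply: eq_bigr => q _; rewrite (tlift_pure _ _ bil).
Qed.

Lemma tact_sum (K : Type) (r : seq K) (F : K -> H) y :
  tact (\sum_(l <- r) F l) y = \sum_(l <- r) tact (F l) y.
Proof.
exact: (big_morph _ (linD (tact_linearl y)) (lin0 (tact_linearl y))).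
Qed.

Lemma tact_nat n y : tact n%:R y = y *+ n.
Proof.
elim: n => [|n IH]; first by rewrite (lin0 (tact_linearl y)).
by rewrite !mulrS (linD (tact_linearl y)) tact1 IH.
Qed.

Definition coinv n : T ⊗ T :=
  \sum_p tact (antipode hH (mcoef n p)) (t p \ot (1 : T)).

Lemma coinv_gen q : \sum_i tact (mcoef q i) (coinv i) = t q \ot (1 : T).
Proof.
under eq_bigr do rewrite linear_sum /=.
rewrite exchange_big /=.
under eq_bigr => p _.
  under eq_bigr do rewrite -tactM.
  rewrite -tact_sum antipode_mcoefr tact_nat; over.
rewrite /= (bigD1 q) //= eqxx big1 ?addr0 // => p pq.
by rewrite eq_sym (negPf pq).
Qed.

(* With coinv n = tau(S(t_n(-1))) (t_n(0) (x) 1), this and coinv_gen are the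
   fundamental theorem of Hopf modules for T (x) T^op.  Applying the coaction to
   coinv_gen and cancelling first the matrix mcoef in H, then its image under the
   action of H, avoids the anticomultiplicativity of the antipode. *)
Lemma lcoact2_coinv n : lcoact2 (coinv n) = (1 : H) \ot coinv n.
Proof.
(* The coaction of [coinv_gen] involves two matrix products, in H and on T (x) T; [Y] is the second
   one alone. *)
pose Y l : H ⊗ (T ⊗ T) := \sum_i tmap idfun (tact (mcoef l i)) (lcoact2 (coinv i)).
have YE q : \sum_l tmap (lmul (mcoef q l)) idfun (Y l) =
    \sum_l mcoef q l \ot (t l \ot (1 : T)).
  have := congr1 lcoact2 (coinv_gen q).
  rewrite lcoact2_pure lcoact_mcoef (linear_sum (tmap _ _)).
  under [X in _ = X -> _]eq_bigr do rewrite /= tmapE.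
  move=> /= <-; rewrite linear_sum /=.
  under [RHS]eq_bigr do rewrite (lcoact2_tact _ (comul_mcoef _ _)).
  rewrite exchange_big /=; apply: eq_bigr => l _.
  by rewrite linear_sum; apply: eq_bigr => i _; rewrite /= tmap_comp.
have Y1 j : Y j = (1 : H) \ot (t j \ot (1 : T)).
  have inv (Z : 'I_m -> H ⊗ (T ⊗ T)) :
      \sum_q tmap (lmul (antipode hH (mcoef j q))) idfun
        (\sum_l tmap (lmul (mcoef q l)) idfun (Z l)) = Z j.
    under eq_bigr do rewrite linear_sum /=.
    rewrite exchange_big /= (bigD1 j) //=.
    have E l : \sum_q tmap (lmul (antipode hH (mcoef j q))) idfun
        (tmap (lmul (mcoef q l)) idfun (Z l)) = Z l *+ (j == l).
      elim/tens_ind: (Z l) => [|x y hx hy|h v].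
      - by rewrite mul0rn big1 // => q _; rewrite !linear0.
      - by rewrite mulrnDl -hx -hy -big_split; apply: eq_bigr => q _; rewrite !linearD.
      - under eq_bigr do rewrite !tmapE /= /lmul mulrA.
        rewrite -[RHS]scaler_nat -pureZl scaler_nat.
        rewrite -(big_morph (rpure v) (linearD (rpure v)) (linear0 (rpure v))).
        by rewrite -mulr_suml antipode_mcoefl mulr_natl.
    rewrite E eqxx big1 ?addr0 // => l lj.
    by rewrite E eq_sym (negPf lj).
  rewrite -[LHS]inv.
  under eq_bigr do rewrite YE.
  rewrite -[RHS](inv (fun l => (1 : H) \ot (t l \ot (1 : T)))).
  apply: eq_bigr => q _; congr (tmap _ _ _); apply: eq_bigr => l _.
  by rewrite tmapE /= /lmul mulr1.
have <- : \sum_j tmap idfun (tact (antipode hH (mcoef n j))) (Y j) =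
    lcoact2 (coinv n).
  under eq_bigr do rewrite linear_sum /=.
  rewrite exchange_big /= (bigD1 n) //=.
  have E i : \sum_j tmap idfun (tact (antipode hH (mcoef n j)))
      (tmap idfun (tact (mcoef j i)) (lcoact2 (coinv i))) =
      lcoact2 (coinv i) *+ (n == i).
    elim/tens_ind: (lcoact2 (coinv i)) => [|x y hx hy|h v].
    - by rewrite mul0rn big1 // => q _; rewrite !linear0.
    - by rewrite mulrnDl -hx -hy -big_split; apply: eq_bigr => q _; rewrite !linearD.
    - under eq_bigr do rewrite !tmapE /= -tactM.
      rewrite -[RHS]scaler_nat -pureZr scaler_nat.
      rewrite -(big_morph (pure h) (linearD (pure h)) (linear0 (pure h))).
      by rewrite -tact_sum antipode_mcoefl tact_nat.
  rewrite E eqxx big1 ?addr0 // => l lj.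
  by rewrite E eq_sym (negPf lj).
rewrite linear_sum; apply: eq_bigr => j _.
by rewrite Y1 tmapE.
Qed.

Hypothesis coinvT : forall u : T, rho u = (1 : H) \ot u -> exists a : k, u = a *: (1 : T).

(** Since T has coinvariants k, those of T (x) T are 1 (x) T, so [coinv i] is 1 (x) g_i. Multiplying
    [coinv_gen] by s on the right in the second factor gives the formula. *)
Lemma twist_exists : exists g : 'I_m -> T, forall q s,
  t q \ot s = \sum_i tmap idfun (lmul (g i)) (bi (mcoef q i \ot s)).
Proof.
have coinv1 i : exists g, coinv i = (1 : T) \ot g.
  have /choice[a aE] p : exists a : k, tcoord c p (coinv i) = a *: (1 : T).
    apply: coinvT; rewrite -tcoord_tmap -tcoord_tassoc -/(lcoact2 _).
    by rewrite lcoact2_coinv tmapE.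
  exists (\sum_p a p *: t p); rewrite [LHS](tcoord_sum tc) linear_sum.
  by apply: eq_bigr => p _; rewrite aE pureZl linearZ.
have /choice[g gE] := coinv1; exists g => q s.
have -> : t q \ot s = tmap idfun (rmul s) (t q \ot (1 : T)).
  by rewrite tmapE /= /rmul mul1r.
rewrite -coinv_gen linear_sum; apply: eq_bigr => i _ /=.
have -> : mcoef q i \ot s = tmap idfun (rmul s) (mcoef q i \ot (1 : T)).
  by rewrite tmapE /= /rmul mul1r.
rewrite bi_rmul gE tact_pure /tau !tmap_comp; congr tmap; apply/funext => x /=.
  by rewrite /rmul mulr1.
by rewrite /rmul /lmul mulrA.
Qed.

End Torsor.

(** * The cotensor algebra *)

Section CotensorMatrix.
Variables (k : fieldType) (H : pzAlgType k) (hH : hopf_algebra H).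
Variables (T : pzAlgType k) (rho : left_comodule_algebra hH T).
Variable bi : {linear H ⊗ T -> T ⊗ T}.
Hypotheses (biK : cancel (torsor_map rho) bi) (Kbi : cancel bi (torsor_map rho)).
Variables (m : nat) (t : 'I_m -> T) (c : 'I_m -> {linear T -> k^o}).
Hypothesis tc : forall w, w = \sum_i (c i w : k) *: t i.
Hypothesis ct : forall i j, c i (t j) = (i == j)%:R.
Variables (A : pzAlgType k) (rA : right_comodule_algebra hH A).
Variables (G : graded_ring A) (kG : graded_algebra G).
Hypothesis cG : graded_coaction rA G.

Let C := cotensor rA rho.
Let GC : graded_ring C := cotensor_graded rho kG cG.

Definition one_ot (s : T) : A ⊗ T := (1 : A) \ot s.

Lemma mul_one_ot (x : A ⊗ T) s : x * one_ot s = tmap idfun (rmul s) x.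
Proof.
rewrite /one_ot mul_tmap; congr tmap; apply/funext => a /=.
by rewrite /rmul mulr1.
Qed.

(** The matrix of right multiplication by a in the left basis, b_i a = \sum_p [coef_fun i p a] b_p;
    in Sweedler notation the entry is a(0) (x) [transl] applied to a(1). *)
Definition coef_fun i p (a : A) : A ⊗ T :=
  tmap idfun (transl bi c (t i) p) (rA a).

(** Colinearity of [transl] moves [rho] to the comultiplication of H, and coassociativity of [rA]
    moves it on to A. *)
Lemma coef_fun_mem i p a : coef_fun i p a \in cotensor_pred rA rho.
Proof.
apply/asboolP; rewrite /cotensor_lhs /cotensor_rhs /coef_fun [RHS]tmap_comp.
have -> : tmap (idfun \o idfun) (rho \o transl bi c (t i) p) (rA a) =
    tmap idfun (tmap idfun (transl bi c (t i) p)) (tmap idfun (comul hH) (rA a)).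
  rewrite tmap_comp; congr tmap; apply/funext => h.
  exact: (transl_coact biK Kbi).
rewrite -rcoactA -tassoc_tmap !tmap_comp; congr (tassoc (tmap _ _ _)).
by apply/funext => x /=; rewrite tmap_id.
Qed.

Lemma coef_fun_sum i a : \sum_p coef_fun i p a * one_ot (t p) = a \ot t i.
Proof.
under eq_bigr do rewrite mul_one_ot tmap_comp.
pose f (h : H) : T := (counit hH h : k) *: t i.
have lf : linear f by move=> b x y; rewrite /f linearP scalerDl scalerA.
pose F : {linear H -> T} := HB.pack f (GRing.isLinear.Build k H T *:%R f lf).
rewrite -(@tmap_sumr _ _ _ _ _ _ (index_enum 'I_m) _ F
  (fun p => rmul (t p) \o transl bi c (t i) p)); last first.
  by move=> h; rewrite -[LHS](transl_counit Kbi tc).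
rewrite -[in RHS](rcoact1 rA a).
have bil : bilinear_for *:%R *:%R (fun (x : A) (h : H) => (counit hH h : k) *: x).
  split=> [h b x y|x b g h] /=; first by rewrite scalerDr !scalerA mulrC.
  by rewrite linearP scalerDl scalerA.
have ll := tlift_linear bil.
elim/tens_ind: (rA a) => [|x y hx hy|b h].
- by rewrite linear0 (lin0 ll) pure0l.
- by rewrite linearD (linD ll) pureDl /= hx hy.
- by rewrite tmapE (tlift_pure _ _ bil) pureZl linearZ.
Qed.

(** On C, applying rA (x) id to the relation is the same as applying id (x) [torsor_map rho] to the
    sum of the x_p (x) t_p. Injectivity of the torsor map kills this sum, and its coordinates are
    the x_p. *)
Lemma cotensor_free (x : 'I_m -> A ⊗ T) :
  (forall p, x p \in cotensor_pred rA rho) ->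
  \sum_p x p * one_ot (t p) = 0 -> forall p, x p = 0.
Proof.
move=> xC x0 p.
pose Y : A ⊗ (T ⊗ T) := \sum_p tmap idfun (rpure (t p)) (x p).
have Y0 : tmap idfun (torsor_map rho) Y = 0.
  have := congr1 (fun z => tassoc (tmap rA idfun z)) x0.
  rewrite (linear0 (tmap rA idfun)) linear0 => <-; rewrite /Y.
  rewrite (linear_sum (tmap idfun (torsor_map rho))) (linear_sum (tmap rA idfun)).
  rewrite (linear_sum (@tassoc k A H T)); apply: eq_bigr => q _ /=.
  rewrite mul_one_ot !tmap_comp.
  have -> : tmap (rA \o idfun) (idfun \o rmul (t q)) (x q) =
      tmap (tmap idfun idfun) (rmul (t q)) (tmap rA idfun (x q)).
    rewrite tmap_comp; congr tmap; apply/funext => a.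
    by rewrite /= tmap_id.
  rewrite tassoc_tmap; have /asboolP := xC q; rewrite /cotensor_lhs => ->.
  rewrite /cotensor_rhs tmap_comp; congr tmap; apply/funext => u.
  by rewrite /= torsor_map_pure.
have {}Y0 : Y = 0 by rewrite -(tmap_idK biK Y) Y0 linear0.
have := congr1 (tmap idfun (tcoord c p)) Y0.
rewrite linear0 /Y linear_sum (bigD1 p) //= big1 => [|q qp].
  rewrite addr0 tmap_comp => h; rewrite -[RHS]h -[LHS]tmap_id; congr tmap.
  by apply/funext => u; rewrite /= tcoord_basis // eqxx.
rewrite tmap_comp; elim/tens_ind: (x q) => [|y z hy hz|a u]; first by rewrite !linear0.
  by rewrite [LHS]linearD -[RHS]addr0; congr (_ + _); [exact: hy|exact: hz].
by rewrite tmapE /= tcoord_basis // eq_sym (negPf qp) linear0.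
Qed.

(** Matrix identities over C are proved by comparing combinations of the b_p in A (x) T. *)
Lemma cotensor_eq (x y : 'I_m -> C) :
  \sum_p val (x p) * one_ot (t p) = \sum_p val (y p) * one_ot (t p) ->
  forall p, x p = y p.
Proof.
move=> /eqP; rewrite -subr_eq0 -sumrB => /eqP xy p; apply/val_inj/eqP.
rewrite -subr_eq0; apply/eqP.
apply: (cotensor_free (x := fun p => val (x p) - val (y p))) => [q|].
  by rewrite -raddfB; apply: cotensorP.
by under eq_bigr do rewrite mulrBl.
Qed.

Definition coef i p (a : A) : C := Cotensor (coef_fun_mem i p a).

(** The matrix of left multiplication by x in the right A-basis: x b_p = \sum_j b_j
    [cocoef j p x]. *)
Definition cocoef j p (x : C) : A := tcoord c j (val x * one_ot (t p)).

Lemma cocoef_sum p x : val x * one_ot (t p) = \sum_j cocoef j p x \ot t j.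
Proof. exact: (tcoord_sum tc). Qed.

Lemma coefD i p : {morph coef i p : x y / x + y}.
Proof.
by move=> x y; apply: val_inj; rewrite raddfD /= /coef_fun !linearD.
Qed.

Lemma sum_delta_mul i (F : 'I_m -> A ⊗ T) :
  \sum_p val ((i == p)%:R : C) * F p = F i.
Proof.
rewrite (bigD1 i) //= eqxx rmorph1 mul1r big1 ?addr0 // => p pi.
by rewrite eq_sym (negPf pi) rmorph0 mul0r.
Qed.

Lemma coef1 i p : coef i p 1 = (i == p)%:R.
Proof.
move: p; apply: cotensor_eq; rewrite sum_delta_mul.
exact: coef_fun_sum.
Qed.

Lemma coefM i j x y : coef i j (x * y) = \sum_p coef i p x * coef p j y.
Proof.
move: j; apply: cotensor_eq; rewrite [LHS]coef_fun_sum.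
under [RHS]eq_bigr do rewrite raddf_sum mulr_suml.
rewrite exchange_big /=.
under [RHS]eq_bigr => p _.
  under eq_bigr do rewrite -mulrA.
  rewrite -mulr_sumr coef_fun_sum.
  rewrite (_ : y \ot t p = one_ot (t p) * (y \ot (1 : T) : A ⊗ T)); last first.
    by rewrite /one_ot mul_pure mul1r mulr1.
  rewrite mulrA; over.
by rewrite /= -mulr_suml coef_fun_sum mul_pure mulr1.
Qed.

Lemma coef_deg i p d x : G d x -> GC d (coef i p x).
Proof.
move=> /cG[s [sG xE]]; rewrite /GC /= /cotensor_comp /= /coef_fun xE.
exists [seq (q.1, transl bi c (t i) p q.2) | q <- s]; split.
  by move=> q /mapP[q' /sG Gq' ->].
rewrite big_map linear_sum; apply: eq_bigr => q _.
by rewrite /= tmapE.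
Qed.

Definition coef_mxhom : mxhom G GC m := MxHom coefD coef1 coefM coef_deg.

Lemma cocoefD i p : {morph cocoef i p : x y / x + y}.
Proof. by move=> x y; rewrite /cocoef raddfD mulrDl linearD. Qed.

Lemma cocoef1 i p : cocoef i p 1 = (i == p)%:R.
Proof. by rewrite /cocoef rmorph1 mul1r /one_ot tcoord_basis. Qed.

Lemma cocoefM i j x y : cocoef i j (x * y) = \sum_p cocoef i p x * cocoef p j y.
Proof.
rewrite {1}/cocoef rmorphM -mulrA cocoef_sum mulr_sumr linear_sum.
apply: eq_bigr => p _; rewrite /cocoef /=.
have -> : cocoef p j y \ot t p =
    (one_ot (t p) * (cocoef p j y \ot (1 : T) : A ⊗ T)).
  by rewrite /one_ot mul_pure mul1r mulr1.
rewrite mulrA; move: (_ * one_ot (t p)) => z; rewrite mul_tmap.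
rewrite (_ : tmap _ _ = tmap (rmul (cocoef p j y)) idfun) ?tcoord_tmap //.
by congr tmap; apply/funext => u; rewrite /= /rmul mulr1.
Qed.

Lemma cocoef_deg i p d x : GC d x -> G d (cocoef i p x).
Proof.
move=> [s [sG xE]]; rewrite /cocoef xE mulr_suml linear_sum big_seq.
elim/big_rec: _ => [|q y qs Gy]; first exact: (gr_zero (gr_grading G)).
apply: (grD (gr_grading G)) => //.
by rewrite /= /one_ot mul_pure mulr1 tcoordE; apply/kG/sG.
Qed.

Definition cocoef_mxhom : mxhom GC G m :=
  MxHom cocoefD cocoef1 cocoefM cocoef_deg.

Lemma coef_cocoef p q x : \sum_j coef j q (cocoef j p x) = x *+ (p == q).
Proof.
move: q; apply: cotensor_eq.
under [LHS]eq_bigr do rewrite raddf_sum mulr_suml.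
rewrite exchange_big /=; under [LHS]eq_bigr do rewrite coef_fun_sum.
rewrite -cocoef_sum [RHS](bigD1 p) // eqxx mulr1n big1 => [|q /= qp].
  exact/esym/addr0.
by rewrite eq_sym (negPf qp) mulr0n [cotensor_val _](raddf0 (val : C -> A ⊗ T)) mul0r.
Qed.

Lemma cocoef_coef i j a : \sum_p cocoef j p (coef i p a) = a *+ (i == j).
Proof.
rewrite /cocoef -(linear_sum (tcoord c j)) coef_fun_sum /= tcoord_basis //.
by rewrite eq_sym.
Qed.

Lemma cotensor_const_mem (a : k) :
  a *: (1 : A ⊗ T) \in cotensor_pred rA rho.
Proof.
have [/asboolP h _ _] := cotensor_subring rA rho; apply/asboolP.
move: h; rewrite /cotensor_lhs /cotensor_rhs => h.
by rewrite /cotensor_lhs /cotensor_rhs !linearZ /= h.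
Qed.

Definition cotensor_const a : C := Cotensor (cotensor_const_mem a).

(** The p-th coordinate of the equation defining C: the coordinates of x span a subcomodule of A
    with coefficients [mcoef]. *)
Lemma rcoact_cotensor (x : C) p :
  rA (tcoord c p (cotensor_val x)) =
  \sum_n tcoord c n (cotensor_val x) \ot mcoef rho t c n p.
Proof.
have /asboolP/(congr1 (tmap idfun (tcoord c p))) := cotensorP x.
rewrite /cotensor_lhs tcoord_tassoc tcoord_tmap => ->.
rewrite [in LHS](tcoord_sum tc (cotensor_val x)) /cotensor_rhs.
rewrite (linear_sum (tmap idfun rho)) (linear_sum (tmap idfun (tcoord c p))).
by apply: eq_bigr => n _; rewrite /= !tmapE.
Qed.

(** The constant matrices are those of left multiplication by t_l on T. If x = \sum_n y_n (x) t_n,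
    the elements a_l are the combinations of the y_n with weights the l-th coordinates of g_n, so
    that the sum over l reassembles multiplication by g_n. *)
Lemma coef_gen (g : 'I_m -> T) :
  (forall q s, t q \ot s =
     \sum_n tmap idfun (lmul (g n)) (bi (mcoef rho t c q n \ot s))) ->
  forall x, exists a : 'I_m -> A, forall i p,
    \sum_l \sum_q coef i q (a l) * cotensor_const (c p (t l * t q)) =
    x *+ (i == p).
Proof.
move=> gE x; pose y n := tcoord c n (cotensor_val x).
exists (fun l => \sum_n (c l (g n) : k) *: y n) => i p.
(* [K s h] is the p-th coordinate of the inverse torsor map at h (x) t_i after left multiplication
   by s in the second factor. *)
pose K s : {linear H -> T} :=
  tcoord c p \o (tmap idfun (lmul s) \o (bi \o rpure (t i))).
have KE s h : K s h = \sum_q (c p (s * t q) : k) *: transl bi c (t i) q h.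
  rewrite /K /= [in LHS](tcoord_sum tc (bi _)).
  rewrite (linear_sum (tmap idfun (lmul s))) (linear_sum (tcoord c p)).
  by apply: eq_bigr => q _; rewrite /= tmapE tcoordE.
have coefE l b : \sum_q (c p (t l * t q) : k) *: coef_fun i q b =
    tmap idfun (K (t l)) (rA b).
  rewrite /coef_fun; elim/tens_ind: (rA b) => [|u v hu hv|u h].
  - by rewrite linear0 big1 // => q _; rewrite linear0 scaler0.
  - rewrite linearD /= -hu -hv -big_split; apply: eq_bigr => q _.
    by rewrite linearD scalerDr.
  - rewrite tmapE KE linear_sum; apply: eq_bigr => q _.
    by rewrite tmapE /= pureZr.
apply: val_inj; rewrite (raddf_sum (val : C -> A ⊗ T)).
transitivity (\sum_l tmap idfun (K (t l)) (rA (\sum_n (c l (g n) : k) *: y n))).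
  apply: eq_bigr => l _; rewrite -coefE (raddf_sum (val : C -> A ⊗ T)).
  by apply: eq_bigr => q _; rewrite /= -pzscalerAr mulr1.
transitivity (\sum_n tmap idfun (K (g n)) (rA (y n))).
  under eq_bigr do rewrite !linear_sum /=.
  rewrite exchange_big /=; apply: eq_bigr => n _.
  under eq_bigr do rewrite !linearZ /=.
  elim/tens_ind: (rA (y n)) => [|u v hu hv|u h].
  - by rewrite linear0 big1 // => l _; rewrite linear0 scaler0.
  - rewrite linearD /= -hu -hv -big_split; apply: eq_bigr => l _.
    by rewrite linearD scalerDr.
  - under eq_bigr do rewrite tmapE -linearZ.
    rewrite -linear_sum tmapE KE; congr (_ \ot _).
    under eq_bigr do rewrite KE scaler_sumr.
    rewrite exchange_big /=; apply: eq_bigr => q _.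
    have -> : (c p (g n * t q) : k) =
        \sum_l (c l (g n) : k) * (c p (t l * t q) : k).
      rewrite [in LHS](tc (g n)) mulr_suml linear_sum.
      by apply: eq_bigr => l _; rewrite -pzscalerAl linearZ.
    by rewrite scaler_suml; apply: eq_bigr => l _; rewrite scalerA.
rewrite (raddfMn (val : C -> A ⊗ T)) /=.
transitivity (\sum_n y n \ot (t n *+ (i == p))); last first.
  rewrite [in RHS](tcoord_sum tc (cotensor_val x)) -sumrMnl.
  by apply: eq_bigr => n _; rewrite raddfMn.
under eq_bigr do rewrite rcoact_cotensor linear_sum.
rewrite exchange_big /=; apply: eq_bigr => n _.
under eq_bigr do rewrite tmapE.
rewrite -linear_sum; congr (_ \ot _).
(* The hypothesis on g turns the sum into t_n (x) t_i, whose p-th coordinate is t_n if i = p and 0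
   otherwise. *)
rewrite /K /= -(linear_sum (tcoord c p)) -gE /= tcoord_basis //.
by rewrite eq_sym.
Qed.

End CotensorMatrix.

(** * Condition chi for the cotensor algebra *)

Theorem theorem4p12
  (k : fieldType)
  (H : pzAlgType k) (hH : hopf_algebra H)
  (H_comm : commutative (@GRing.mul H)) (H_fin : finitely_generated H)
  (T : pzAlgType k) (rhoT : left_comodule_algebra hH T)
  (T_torsor : is_torsor rhoT)
  (A : pzAlgType k) (rhoA : right_comodule_algebra hH A)
  (G : graded_ring A) (G_alg : graded_algebra G)
  (G_coact : graded_coaction rhoA G) :
  condition_chi G -> condition_chi (cotensor_graded rhoT G_alg G_coact).
Proof.
have [[f [f' fK f'K] _] coinvT _] := T_torsor.
have T_fin : finitely_generated T.
  have [n [e eP]] := H_fin; exists n, (fun i => f' (e i)) => v.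
  have [a aE] := eP (f v); exists a; rewrite -[LHS]fK aE.
  apply: (can_inj fK); rewrite f'K linear_sum.
  by apply: eq_bigr => i _; rewrite linearZ /= f'K.
have [m [t [c [tc ct]]]] := fin_gen_basis T_fin.
(* The dimension m is positive: H is nonzero because its counit sends 1 to 1, and T is isomorphic to
   H. *)
have p : 'I_m.
  case: m t c tc ct => [|m] t c tc _; last exact: ord0.
  have T0 (v : T) : v = 0 by rewrite [v]tc big_ord0.
  have H0 : 1 = 0 :> H by rewrite -[LHS]f'K [f' _]T0 linear0.
  have := (counit_morphism hH).1; rewrite H0 linear0.
  by move/eqP; rewrite eq_sym oner_eq0.
have [bi biK Kbi] := torsor_map_inverse (torsor_galois T_torsor).
have coinv u : rhoT u = (1 : H) \ot u -> exists a : k, u = a *: (1 : T).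
  by move/coinvT.
have [g gE] := twist_exists biK Kbi tc ct coinv.
have sw := coef_cocoef biK Kbi tc ct (rA := rhoA).
have ws := cocoef_coef biK Kbi tc ct rhoA.
exact: (condition_chi_transfer (s := coef_mxhom biK Kbi tc ct G_alg G_coact)
  (w := cocoef_mxhom rhoT tc ct G_alg G_coact) sw ws p
  (coef_gen biK Kbi tc ct gE)).
Qed.
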